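(* Let $\Lambda_1\geq 0$ and $\Lambda_2>1$. Let $F(z)=\bar{z}G(z)+H(z)$, $z\in\mathbb{D}=\{z:|z|<1\}$, where $G$ and $H$ are analytic in $\mathbb{D}$ with $G(0)=0$, $H(0)=0$, $H'(0)=1$, $|G'(z)|\leq \Lambda_1$ and $|H'(z)|<\Lambda_2$ for all $z\in\mathbb{D}$. Set $$\rho_1=\frac{2\Lambda_2}{\Lambda_2(2\Lambda_1+\Lambda_2)+\sqrt{\Lambda_2^2(2\Lambda_1+\Lambda_2)^2-8\Lambda_1\Lambda_2}},$$ $$F_1(z)=\Lambda_2^2 z-\Lambda_1|z|^2+(\Lambda_2^3-\Lambda_2)\ln\Big(1-\frac{z}{\Lambda_2}\Big),\qquad \sigma_1=F_1(\rho_1)=\Lambda_2^2\rho_1-\Lambda_1\rho_1^2+(\Lambda_2^3-\Lambda_2)\ln\Big(1-\frac{\rho_1}{\Lambda_2}\Big).$$ Then $F$ is univalent in $\mathbb{D}_{\rho_1}$ and $F(\mathbb{D}_{\rho_1})\supseteq\mathbb{D}_{\sigma_1}$. This result is sharp: the function $F_1$ (principal branch of the logarithm) satisfies the hypotheses, is not univalent in $\mathbb{D}_r$ for any $r\in(\rho_1,1]$, and $|F_1(\rho_1)|=\sigma_1$ with $\rho_1\in\partial\mathbb{D}_{\rho_1}$.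
   Context: $\mathbb{D}_r=\{z\in\mathbb{C}:|z|<r\}$. A function of the form $\bar z G(z)+H(z)$ with $G,H$ analytic is called bi-analytic (it satisfies $F_{\bar z\bar z}=0$). *)

(* Defs.v *)
From Stdlib Require Import Reals.
From Coquelicot Require Export Coquelicot.
Open Scope R_scope.

Definition cdisc (r : R) (z : C) : Prop := Cmod z < r.

Definition has_cderiv (f : C -> C) (z l : C) : Prop :=
  @is_derive C_AbsRing C_NormedModule f z l.

Definition univalent_on (f : C -> C) (A : C -> Prop) : Prop :=
  forall z w, A z -> A w -> f z = f w -> z = w.

(* principal argument in (-PI, PI] (atan2) *)
Definition Carg (w : C) : R :=
  let x := Re w in let y := Im w in
  match Rlt_dec 0 x with
  | left _ => atan (y / x)
  | right _ =>
    match Rlt_dec x 0 with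
    | left _ => if Rle_dec 0 y then atan (y / x) + PI else atan (y / x) - PI
    | right _ => if Rlt_dec 0 y then PI / 2
                 else if Rlt_dec y 0 then - (PI / 2) else 0
    end
  end.

Definition Clog (w : C) : C := (RtoC (ln (Cmod w)) + Ci * RtoC (Carg w))%C.

Definition rho1 (L1 L2 : R) : R :=
  2 * L2 / (L2 * (2 * L1 + L2)
            + sqrt (L2 ^ 2 * (2 * L1 + L2) ^ 2 - 8 * L1 * L2)).

(* the extremal function F_1 and its decomposition F_1 = conj z * G_1 + H_1 *)
Definition F1 (L1 L2 : R) (z : C) : C :=
  (RtoC (L2 ^ 2) * z - RtoC (L1 * Cmod z ^ 2)
   + RtoC (L2 ^ 3 - L2) * Clog (1 - z / RtoC L2))%C.
Definition G1 (L1 : R) (z : C) : C := (- RtoC L1 * z)%C.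
Definition H1 (L2 : R) (z : C) : C :=
  (RtoC (L2 ^ 2) * z + RtoC (L2 ^ 3 - L2) * Clog (1 - z / RtoC L2))%C.

Definition sigma1 (L1 L2 : R) : R :=
  let r := rho1 L1 L2 in
  L2 ^ 2 * r - L1 * r ^ 2 + (L2 ^ 3 - L2) * ln (1 - r / L2).

Definition hyp (L1 L2 : R) (G H G' H' : C -> C) : Prop :=
  (forall z, cdisc 1 z -> has_cderiv G z (G' z)) /\
  (forall z, cdisc 1 z -> has_cderiv H z (H' z)) /\
  G 0%C = 0%C /\ H 0%C = 0%C /\ H' 0%C = 1%C /\
  (forall z, cdisc 1 z -> Cmod (G' z) <= L1) /\
  (forall z, cdisc 1 z -> Cmod (H' z) < L2).

(* Main.v *)
Require Import Defs.
From Stdlib Require Import Reals Ranalysis5 Lra Lia Psatz.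
From Coquelicot Require Import Coquelicot.
Open Scope R_scope.

(** The hypothesis |H'| < L2 with H'(0) = 1 and Schwarz--Pick give
    Re H'(z) >= L2 (1 - L2 r) / (L2 - r) for |z| = r, and |G(z)| <= L1 r. Differentiating F
    along a segment in the direction d then gives
    Re (conj d dF) >= |d|^2 mu(r) with mu(r) = L2 (1 - L2 r) / (L2 - r) - 2 L1 r, a decreasing
    function whose zero is rho1. Hence F is strongly monotone, so injective, on smaller
    discs; integrating mu along a radius bounds Re (conj z F(z)) below by |z| sigma_at(|z|),
    where sigma_at is the primitive of mu, and a strongly monotone Lipschitz map with this
    property on a circle attains every value smaller than sigma_at there. On the real axis
    F1 restricts to sigma_at, which turns around at rho1.

    Only pointwise complex differentiability is assumed, so Schwarz--Pick rests on Goursat's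
    bisection argument, which logarithmic coordinates turn into the mean value property. *)

(** * Goursat's theorem on rectangles *)

(** The numerator of [mu] is [2 * L1 * r ^ 2 - L2 * (2 * L1 + L2) * r + L2]. For [L1 > 0] the number
    [rho1] is its smaller root, written with the square root in the denominator so that the formula
    also covers [L1 = 0]. As [mu] vanishes at [rho1], no uniform monotonicity holds on the whole
    disc: the arguments run on closed discs of radius s < [rho1], and strict inequalities supply the
    slack. Uniform monotonicity on such a disc turns the covering statement into a contraction
    argument, so no degree theory or open mapping theorem enters.

    [F1] is built to make the estimates equalities on the positive axis. With a = 1 / L2, the
    derivative of [H1] is L2 times the disc automorphism (a - z) / (1 - a z), extremal for
    Schwarz--Pick, and [G1] makes each of the two terms coming from G equal to - L1 r. *)

Lemma nested_intervals (u l : nat -> R) :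
  (forall n, u n <= u (S n)) -> (forall n, u (S n) + l (S n) <= u n + l n) ->
  (forall n, 0 <= l n) ->
  exists x, forall n, u n <= x <= u n + l n.
Proof.
intros hu hl hpos.
assert (mu : forall n k, u n <= u (n + k)%nat).
{ intros n k; induction k as [|k IH]; [rewrite Nat.add_0_r; lra|].
  rewrite Nat.add_succ_r; specialize (hu (n + k)%nat); lra. }
assert (ml : forall n k, u (n + k)%nat + l (n + k)%nat <= u n + l n).
{ intros n k; induction k as [|k IH]; [rewrite Nat.add_0_r; lra|].
  rewrite Nat.add_succ_r; specialize (hl (n + k)%nat); lra. }
(* Left end [n] and right end [m] are compared at the common index [n + m], where both have only
   moved inwards. *)
assert (key : forall n m, u n <= u m + l m).
{ intros n m. pose proof (mu n m). pose proof (ml m n).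
  rewrite (Nat.add_comm m n) in H0. specialize (hpos (n + m)%nat). lra. }
destruct (completeness (fun y => exists n, y = u n)) as [x [hx1 hx2]].
- exists (u 0%nat + l 0%nat); intros y [n ->]; apply key.
- exists (u 0%nat); now exists 0%nat.
- exists x; intros n; split.
  + apply hx1; now exists n.
  + apply hx2; intros y [m ->]; apply key.
Qed.

(* If the total is positive, one quarter always keeps a quarter of it, and the
   nested quarters shrink to a point contradicting the local estimate. *)
Lemma rectangle_bisection (a b c d : R) (N : R -> R -> R -> R -> R) :
  a <= b -> c <= d ->
  (forall x y w h, 0 <= w -> 0 <= h -> a <= x -> x + w <= b -> c <= y -> y + h <= d ->
     N x y w h <= N x y (w / 2) (h / 2) + N (x + w / 2) y (w / 2) (h / 2)
       + N x (y + h / 2) (w / 2) (h / 2) + N (x + w / 2) (y + h / 2) (w / 2) (h / 2)) ->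
  (forall x0 y0, a <= x0 <= b -> c <= y0 <= d -> forall eps, 0 < eps ->
     exists del, 0 < del /\ forall x y w h, 0 <= w < del -> 0 <= h < del ->
       a <= x -> x + w <= b -> c <= y -> y + h <= d ->
       x <= x0 <= x + w -> y <= y0 <= y + h -> N x y w h <= eps * (w + h) ^ 2) ->
  N a c (b - a) (d - c) <= 0.
Proof.
intros hab hcd hsub hloc.
set (W := b - a). set (H := d - c). set (N0 := N a c W H).
destruct (Rle_dec N0 0) as [|hN0]; [assumption|exfalso].
apply Rnot_le_lt in hN0.
set (big := fun k x y =>
  Rle_dec (N0 * (/ 4) ^ k) (N x y (W * (/ 2) ^ k) (H * (/ 2) ^ k))).
(* The fourth quarter is taken without a test: when the other three fall short, subadditivity makes
   it large. *)
set (step := fun k (p : R * R) => let (x, y) := p in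
  let w := W * (/ 2) ^ S k in let h := H * (/ 2) ^ S k in
  if big (S k) x y then (x, y)
  else if big (S k) (x + w) y then (x + w, y)
  else if big (S k) x (y + h) then (x, y + h) else (x + w, y + h)).
set (z := nat_rect (fun _ => (R * R)%type) (a, c) step).
assert (W0 : 0 <= W) by (unfold W; lra). assert (H0 : 0 <= H) by (unfold H; lra).
assert (p2 : forall k, 0 < (/ 2) ^ k) by (intros; apply pow_lt; lra).
assert (Wk : forall k, 0 <= W * (/ 2) ^ k) by (intros k; apply Rmult_le_pos; [|left]; auto).
assert (Hk : forall k, 0 <= H * (/ 2) ^ k) by (intros k; apply Rmult_le_pos; [|left]; auto).
assert (zS : forall k, exists i j : R, (i = 0 \/ i = 1) /\ (j = 0 \/ j = 1) /\
  z (S k) = (fst (z k) + i * (W * (/ 2) ^ S k), snd (z k) + j * (H * (/ 2) ^ S k))).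
{ intros k. change (z (S k)) with (step k (z k)).
  destruct (z k) as [x y]; unfold step; cbn [fst snd].
  destruct (big (S k) x y); [exists 0, 0|
  destruct (big (S k) (x + W * (/ 2) ^ S k) y); [exists 1, 0|
  destruct (big (S k) x (y + H * (/ 2) ^ S k)); [exists 0, 1|exists 1, 1]]];
  (split; [lra|split; [lra|f_equal; ring]]). }
assert (hx : forall k, fst (z k) <= fst (z (S k)) /\
   fst (z (S k)) + W * (/ 2) ^ S k <= fst (z k) + W * (/ 2) ^ k).
{ intros k; destruct (zS k) as (i & j & hi & hj & ->); cbn [fst].
  pose proof (Wk (S k)) as h. replace (W * (/2)^k) with (2 * (W * (/2) ^ S k))
    by (simpl; field).
  destruct hi as [-> | ->]; lra. }
assert (hy : forall k, snd (z k) <= snd (z (S k)) /\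
   snd (z (S k)) + H * (/ 2) ^ S k <= snd (z k) + H * (/ 2) ^ k).
{ intros k; destruct (zS k) as (i & j & hi & hj & ->); cbn [snd].
  pose proof (Hk (S k)) as h. replace (H * (/2)^k) with (2 * (H * (/2) ^ S k))
    by (simpl; field).
  destruct hj as [-> | ->]; lra. }
assert (inside : forall k, a <= fst (z k) /\ fst (z k) + W * (/2)^k <= b /\
   c <= snd (z k) /\ snd (z k) + H * (/2)^k <= d).
{ induction k as [|k IH]; [simpl; unfold W, H; lra|].
  specialize (hx k); specialize (hy k); lra. }
assert (large : forall k, N0 * (/ 4) ^ k <=
   N (fst (z k)) (snd (z k)) (W * (/ 2) ^ k) (H * (/ 2) ^ k)).
{ induction k as [|k IH].
  - simpl; rewrite !Rmult_1_r; fold N0; lra.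
  - change (z (S k)) with (step k (z k)). specialize (inside k).
    destruct (z k) as [x y]; unfold step; cbn [fst snd] in *.
    specialize (hsub x y _ _ (Wk k) (Hk k)).
    replace (W * (/ 2) ^ k / 2) with (W * (/ 2) ^ S k) in hsub by (simpl; field).
    replace (H * (/ 2) ^ k / 2) with (H * (/ 2) ^ S k) in hsub by (simpl; field).
    assert (e4 : (/ 4) ^ k = 4 * (/ 4) ^ S k) by (simpl; field).
    rewrite e4 in IH.
    destruct (big (S k) x y) as [|n1]; [assumption|].
    destruct (big (S k) (x + W * (/ 2) ^ S k) y) as [|n2]; [assumption|].
    destruct (big (S k) x (y + H * (/ 2) ^ S k)) as [|n3]; [assumption|].
    cbn [fst snd]. lra. }
destruct (nested_intervals (fun k => fst (z k)) (fun k => W * (/2)^k)) as [x0 hx0];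
  [intros; apply hx|intros; apply hx|apply Wk|].
destruct (nested_intervals (fun k => snd (z k)) (fun k => H * (/2)^k)) as [y0 hy0];
  [intros; apply hy|intros; apply hy|apply Hk|].
(* Chosen so that [eps * (W + H) ^ 2 <= N0 / 2]: the [k]-th quarter carries at least
   [N0 * (/ 4) ^ k], while the local estimate allows half of that. The [+ 1] covers a rectangle
   degenerate to a point. *)
set (eps := N0 / 2 / ((W + H) ^ 2 + 1)).
assert (q : 0 < (W + H) ^ 2 + 1) by (pose proof (pow2_ge_0 (W + H)); lra).
assert (heps : 0 < eps) by (apply Rdiv_lt_0_compat; lra).
destruct (hloc x0 y0) with (eps := eps) as (del & hdel & hd); auto.
{ pose proof (inside 0%nat); pose proof (hx0 0%nat); lra. }
{ pose proof (inside 0%nat); pose proof (hy0 0%nat); lra. }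
destruct (pow_lt_1_zero (/ 2)) with (y := del / (W + H + 1)) as [k hk].
{ rewrite Rabs_pos_eq; lra. }
{ apply Rdiv_lt_0_compat; lra. }
specialize (hk k (le_n k)). rewrite Rabs_pos_eq in hk by (left; auto).
apply (Rmult_lt_compat_r (W + H + 1)) in hk; [|lra].
unfold Rdiv in hk; rewrite Rmult_assoc, Rinv_l, Rmult_1_r in hk by lra.
pose proof (p2 k) as pk. pose proof (Wk k). pose proof (Hk k).
destruct (inside k) as (i1 & i2 & i3 & i4).
assert (B : N (fst (z k)) (snd (z k)) (W * (/ 2) ^ k) (H * (/ 2) ^ k)
   <= eps * (W * (/ 2) ^ k + H * (/ 2) ^ k) ^ 2).
{ apply hd; auto; nra. }
specialize (large k).
assert (e : (W * (/ 2) ^ k + H * (/ 2) ^ k) ^ 2 = (W + H) ^ 2 * (/ 4) ^ k).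
{ replace (/4) with (/2 * /2) by field. rewrite Rpow_mult_distr. ring. }
rewrite e in B.
assert (p4 : 0 < (/ 4) ^ k) by (apply pow_lt; lra).
assert (hh : eps * ((W + H) ^ 2) <= N0 / 2).
{ unfold eps, Rdiv at 1. rewrite Rmult_assoc.
  apply Rle_trans with (N0 / 2 * 1); [|lra].
  apply Rmult_le_compat_l; [lra|].
  rewrite Rmult_comm. apply Rle_div_l; lra. }
nra.
Qed.

(** Counterclockwise line integral of P dx + Q dy around a rectangle. Opposite sides share one
    integral, so that constants and periodic parts cancel under the integral sign. *)
Definition circulation (P Q : R -> R -> R) (x y w h : R) : R :=
  RInt (fun t => P t y - P t (y + h)) x (x + w)
  + RInt (fun s => Q (x + w) s - Q x s) y (y + h).

Lemma ex_RInt_continuous_on (f : R -> R) (a b : R) :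
  a <= b -> (forall x, a <= x <= b -> continuity_pt f x) -> ex_RInt f a b.
Proof.
intros hab h; apply (@ex_RInt_continuous R_CompleteNormedModule); intros x hx.
apply continuity_pt_filterlim, h. rewrite Rmin_left, Rmax_right in hx; lra.
Qed.

Lemma RInt_split (f : R -> R) (a b c : R) :
  a <= b <= c -> (forall x, a <= x <= c -> continuity_pt f x) ->
  RInt f a c = RInt f a b + RInt f b c.
Proof.
intros hab h; symmetry; apply (RInt_Chasles f);
apply ex_RInt_continuous_on; try lra; intros; apply h; lra.
Qed.

Lemma differentiable_section_l (P : R -> R -> R) x y p q :
  differentiable_pt_lim P x y p q -> continuity_pt (fun t => P t y) x.
Proof.
intros h; apply derivable_continuous_pt; exists p.
replace p with (p * 1 + q * 0) by ring.
apply (derivable_pt_lim_comp_2d P (fun t => t) (fun _ => y)); auto.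
- apply derivable_pt_lim_id.
- apply derivable_pt_lim_const.
Qed.

Lemma differentiable_section_r (P : R -> R -> R) x y p q :
  differentiable_pt_lim P x y p q -> continuity_pt (fun t => P x t) y.
Proof.
intros h; apply derivable_continuous_pt; exists q.
replace q with (p * 0 + q * 1) by ring.
apply (derivable_pt_lim_comp_2d P (fun _ => x) (fun t => t)); auto.
- apply derivable_pt_lim_const.
- apply derivable_pt_lim_id.
Qed.

Lemma Rabs_RInt_le (f : R -> R) (a b M : R) :
  a <= b -> (forall x, a <= x <= b -> continuity_pt f x) ->
  (forall x, a <= x <= b -> Rabs (f x) <= M) -> Rabs (RInt f a b) <= (b - a) * M.
Proof.
intros hab hc hM.
apply (norm_RInt_le_const f a b (RInt f a b) M hab hM).
apply (RInt_correct (V := R_CompleteNormedModule)), ex_RInt_continuous_on; auto.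
Qed.

Lemma circulation_split_l P Q x y w1 w2 h :
  0 <= w1 -> 0 <= w2 ->
  (forall t s, x <= t <= x + (w1 + w2) -> y <= s <= y + h ->
    continuity_pt (fun t => P t s) t /\ continuity_pt (fun s => Q t s) s) ->
  0 <= h ->
  circulation P Q x y (w1 + w2) h =
  circulation P Q x y w1 h + circulation P Q (x + w1) y w2 h.
Proof.
intros h1 h2 hc hh; unfold circulation.
rewrite (RInt_split _ x (x + w1)); [|lra|].
2: { intros t ht. apply continuity_pt_minus; apply hc; lra. }
replace (x + w1 + w2) with (x + (w1 + w2)) by ring.
assert (e : RInt (fun s => Q (x + (w1 + w2)) s - Q x s) y (y + h) =
   RInt (fun s => Q (x + w1) s - Q x s) y (y + h) +
   RInt (fun s => Q (x + (w1 + w2)) s - Q (x + w1) s) y (y + h)).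
{ symmetry; rewrite <- (RInt_plus (V := R_CompleteNormedModule)).
  - apply RInt_ext; intros; unfold plus; simpl; ring.
  - apply ex_RInt_continuous_on; [lra|]; intros; apply continuity_pt_minus; apply hc; lra.
  - apply ex_RInt_continuous_on; [lra|]; intros; apply continuity_pt_minus; apply hc; lra. }
rewrite e; ring.
Qed.

(** Exchanging the coordinates reverses the orientation. Horizontal cuts thereby reduce to vertical
    ones. *)
Lemma circulation_swap P Q x y w h :
  0 <= w -> 0 <= h ->
  (forall t s, x <= t <= x + w -> y <= s <= y + h ->
    continuity_pt (fun t => P t s) t /\ continuity_pt (fun s => Q t s) s) ->
  circulation P Q x y w h = - circulation (fun s t => Q t s) (fun s t => P t s) y x h w.
Proof.
intros hw hh hc; unfold circulation.
assert (o : forall f a b, a <= b -> (forall x, a <= x <= b -> continuity_pt f x) ->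
   RInt (fun x => - f x) a b = - RInt f a b).
{ intros; apply (RInt_opp (V := R_CompleteNormedModule)); apply ex_RInt_continuous_on; auto. }
rewrite Ropp_plus_distr, <- !o; try lra.
- rewrite Rplus_comm; apply f_equal2; apply RInt_ext; intros; simpl; ring.
- intros; apply continuity_pt_minus; apply hc; lra.
- intros; apply continuity_pt_minus; apply hc; lra.
Qed.

Lemma circulation_split_r P Q x y w h1 h2 :
  0 <= h1 -> 0 <= h2 ->
  (forall t s, x <= t <= x + w -> y <= s <= y + (h1 + h2) ->
    continuity_pt (fun t => P t s) t /\ continuity_pt (fun s => Q t s) s) ->
  0 <= w ->
  circulation P Q x y w (h1 + h2) =
  circulation P Q x y w h1 + circulation P Q x (y + h1) w h2.
Proof.
intros p1 p2 hc hw.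
rewrite (circulation_swap P Q x y w (h1 + h2)), (circulation_swap P Q x y w h1),
  (circulation_swap P Q x (y + h1) w h2) by first [lra | intros; apply hc; lra].
rewrite circulation_split_l; try lra.
intros t s ht hs; destruct (hc s t); auto.
Qed.

(** The common [q] says that the y-derivative of P and the x-derivative of Q agree at the point, so
    the linear parts have zero circulation and only the remainder, small compared with the size of
    the rectangle, is integrated. *)
Lemma circulation_local P Q x0 y0 p q s eps :
  differentiable_pt_lim P x0 y0 p q -> differentiable_pt_lim Q x0 y0 q s -> 0 < eps ->
  exists del, 0 < del /\ forall x y w h, 0 <= w < del -> 0 <= h < del ->
    (forall t s, x <= t <= x + w -> y <= s <= y + h ->
      continuity_pt (fun t => P t s) t /\ continuity_pt (fun s => Q t s) s) ->
    x <= x0 <= x + w -> y <= y0 <= y + h ->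
    Rabs (circulation P Q x y w h) <= eps * (w + h) ^ 2.
Proof.
intros dP dQ heps.
assert (he : 0 < eps / 2) by lra.
destruct (dP (mkposreal _ he)) as [d1 h1]. destruct (dQ (mkposreal _ he)) as [d2 h2].
cbn in h1, h2.
exists (Rmin d1 d2); split; [apply Rmin_pos; [apply d1|apply d2]|].
intros x y w h hw hh hc hx hy.
pose proof (Rmin_l d1 d2). pose proof (Rmin_r d1 d2).
assert (bnd : forall u v, x <= u <= x + w -> y <= v <= y + h ->
  eps / 2 * Rmax (Rabs (u - x0)) (Rabs (v - y0)) <= eps / 2 * (w + h)).
{ intros u v hu hv; apply Rmult_le_compat_l; [lra|].
  apply Rmax_lub; apply Rabs_le; lra. }
assert (eP : forall u v, x <= u <= x + w -> y <= v <= y + h ->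
   Rabs (P u v - P x0 y0 - (p * (u - x0) + q * (v - y0))) <= eps / 2 * (w + h)).
{ intros u v hu hv; eapply Rle_trans; [apply h1|apply bnd; auto];
  apply Rabs_def1; lra. }
assert (eQ : forall u v, x <= u <= x + w -> y <= v <= y + h ->
   Rabs (Q u v - Q x0 y0 - (q * (u - x0) + s * (v - y0))) <= eps / 2 * (w + h)).
{ intros u v hu hv; eapply Rle_trans; [apply h2|apply bnd; auto];
  apply Rabs_def1; lra. }
assert (sub : forall f a b c, a <= b -> (forall x, a <= x <= b -> continuity_pt f x) ->
   RInt f a b = RInt (fun x => f x - c) a b + (b - a) * c).
{ intros f a b c hab hf.
  replace ((b - a) * c) with (RInt (fun _ => c) a b)
    by (rewrite (RInt_const (V := R_CompleteNormedModule)); reflexivity).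
  rewrite <- (RInt_plus (V := R_CompleteNormedModule)).
  - apply RInt_ext; intros; unfold plus; simpl; ring.
  - apply ex_RInt_continuous_on; auto; intros.
    apply continuity_pt_minus; [auto|apply continuity_pt_const; intro; reflexivity].
  - apply ex_RInt_const. }
unfold circulation.
assert (cP : forall t, x <= t <= x + w -> continuity_pt (fun t => P t y - P t (y + h)) t)
  by (intros; apply continuity_pt_minus; apply hc; lra).
assert (cQ : forall t, y <= t <= y + h -> continuity_pt (fun s => Q (x + w) s - Q x s) t)
  by (intros; apply continuity_pt_minus; apply hc; lra).
(* The side differences of the linear parts are the constants [- q * h] and [q * w]; their
   integrals, - q h w and q w h, cancel. *)
rewrite (sub _ x (x + w) (- q * h)) by (auto; lra).
rewrite (sub _ y (y + h) (q * w)) by (auto; lra).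
assert (iP : Rabs (RInt (fun t => P t y - P t (y + h) - - q * h) x (x + w))
   <= (x + w - x) * (eps * (w + h))).
{ apply Rabs_RInt_le; [lra| |].
  - intros; apply continuity_pt_minus; [auto|apply continuity_pt_const; intro; reflexivity].
  - intros t ht.
    replace (P t y - P t (y + h) - - q * h) with
     ((P t y - P x0 y0 - (p * (t - x0) + q * (y - y0))) -
      (P t (y + h) - P x0 y0 - (p * (t - x0) + q * (y + h - y0)))) by ring.
    pose proof (eP t y ht ltac:(lra)). pose proof (eP t (y + h) ht ltac:(lra)).
    apply Rabs_le_between in H1. apply Rabs_le_between in H2. apply Rabs_le; lra. }
assert (iQ : Rabs (RInt (fun t => Q (x + w) t - Q x t - q * w) y (y + h))
   <= (y + h - y) * (eps * (w + h))).
{ apply Rabs_RInt_le; [lra| |].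
  - intros; apply continuity_pt_minus; [auto|apply continuity_pt_const; intro; reflexivity].
  - intros t ht.
    replace (Q (x + w) t - Q x t - q * w) with
     ((Q (x + w) t - Q x0 y0 - (q * (x + w - x0) + s * (t - y0))) -
      (Q x t - Q x0 y0 - (q * (x - x0) + s * (t - y0)))) by ring.
    pose proof (eQ x t ltac:(lra) ht). pose proof (eQ (x + w) t ltac:(lra) ht).
    apply Rabs_le_between in H1. apply Rabs_le_between in H2. apply Rabs_le; lra. }
apply Rabs_le_between in iP. apply Rabs_le_between in iQ. apply Rabs_le; simpl; lra.
Qed.

Theorem goursat_rectangle (P Q : R -> R -> R) (a b c d : R) :
  a <= b -> c <= d ->
  (forall x y, a <= x <= b -> c <= y <= d -> exists p q s,
     differentiable_pt_lim P x y p q /\ differentiable_pt_lim Q x y q s) ->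
  circulation P Q a c (b - a) (d - c) = 0.
Proof.
intros hab hcd hd.
assert (hc : forall t s, a <= t <= b -> c <= s <= d ->
  continuity_pt (fun t => P t s) t /\ continuity_pt (fun s => Q t s) s).
{ intros t s ht hs; destruct (hd t s ht hs) as (p & q & r & h1 & h2).
  split; [eapply differentiable_section_l|eapply differentiable_section_r]; eauto. }
assert (h : Rabs (circulation P Q a c (b - a) (d - c)) <= 0).
{ apply (rectangle_bisection a b c d (fun x y w h => Rabs (circulation P Q x y w h))); auto.
  - intros x y w h hw hh h1 h2 h3 h4.
    replace (circulation P Q x y w h) with
      (circulation P Q x y (w / 2 + w / 2) (h / 2 + h / 2)) by (f_equal; field).
    rewrite circulation_split_l; try lra; try (intros; apply hc; lra).
    rewrite 2!circulation_split_r; try lra; try (intros; apply hc; lra).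
    match goal with |- Rabs (?A + ?B + (?C + ?D)) <= _ =>
      pose proof (Rabs_triang (A + B) (C + D)); pose proof (Rabs_triang A B);
      pose proof (Rabs_triang C D) end; lra.
  - intros x0 y0 hx hy eps heps; destruct (hd x0 y0 hx hy) as (p & q & r & h1 & h2).
    destruct (circulation_local P Q x0 y0 p q r eps h1 h2 heps) as (del & hdel & hl).
    exists del; split; auto; intros; apply hl; auto; intros; apply hc; lra. }
pose proof (Rabs_pos (circulation P Q a c (b - a) (d - c))).
destruct (Req_dec (circulation P Q a c (b - a) (d - c)) 0); auto.
apply Rabs_pos_lt in H0; lra.
Qed.

(** * Complex differentiability *)

Ltac cparts := unfold Cminus, Cplus, Copp, Cmult, Cconj, Ci, RtoC, Re, Im in *; cbn [fst snd] in *.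
Ltac cring := cparts; ring.

Definition ccont (f : C -> C) (z : C) : Prop :=
  forall eps, 0 < eps -> exists del, 0 < del /\
    forall w, Cmod (w - z) < del -> Cmod (f w - f z) < eps.

(** An epsilon-delta form of [has_cderiv]; multiplying out the quotient makes the case [w = z]
    harmless. *)
Definition cdiff (f : C -> C) (z l : C) : Prop :=
  forall eps, 0 < eps -> exists del, 0 < del /\
    forall w, Cmod (w - z) < del -> Cmod (f w - f z - l * (w - z)) <= eps * Cmod (w - z).

Lemma Cmod_minus_triangle (a b : C) : Cmod (a - b) <= Cmod a + Cmod b.
Proof. unfold Cminus; rewrite <- (Cmod_opp b); apply Cmod_triangle. Qed.

Lemma Cmod_minus_triangle_rev (a b : C) : Cmod a - Cmod b <= Cmod (a - b).
Proof. pose proof (Cmod_triangle (a - b) b). replace (a - b + b)%C with a in H by ring. lra. Qed.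

Lemma Cmod_minus_sym (a b : C) : Cmod (a - b) = Cmod (b - a).
Proof. rewrite <- Cmod_opp; f_equal; ring. Qed.

Lemma Cmod_self (z : C) : Cmod (z - z) = 0.
Proof. replace (z - z)%C with (RtoC 0) by ring; apply Cmod_0. Qed.

Lemma has_cderiv_cdiff f z l : has_cderiv f z l <-> cdiff f z l.
Proof.
split.
- intros [_ h] eps heps.
  destruct (h z (fun P hP => hP) (mkposreal eps heps)) as [d hd].
  exists d; split; [apply cond_pos|]. intros w hw.
  rewrite (Cmult_comm l). apply (hd w hw).
- intros h; split.
  + split.
    * intros x y; apply (Cmult_plus_distr_r x y l).
    * intros k x; symmetry; apply (Cmult_assoc k x l).
    * exists (Cmod l + 1); split; [pose proof (Cmod_ge_0 l); lra|].
      intros x. change (Cmod (x * l) <= (Cmod l + 1) * Cmod x).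
      rewrite Cmod_mult; pose proof (Cmod_ge_0 l); pose proof (Cmod_ge_0 x); nra.
  + intros x hx eps.
    assert (e : z = x).
    { apply (is_filter_lim_locally_unique (V := AbsRing_NormedModule C_AbsRing)); exact hx. }
    subst x. destruct (h eps (cond_pos eps)) as (d & hd & hd').
    exists (mkposreal d hd); intros w hw; specialize (hd' w hw).
    rewrite (Cmult_comm l) in hd'. exact hd'.
Qed.

Lemma ccont_const c z : ccont (fun _ => c) z.
Proof. intros e he; exists 1; split; [lra|]; intros; rewrite Cmod_self; lra. Qed.

Lemma ccont_id z : ccont (fun w => w) z.
Proof. intros e he; exists e; auto. Qed.

Lemma ccont_plus f g z : ccont f z -> ccont g z -> ccont (fun w => f w + g w)%C z.
Proof.
intros hf hg e he.
destruct (hf (e / 2)) as (d1 & p1 & h1); [lra|]. destruct (hg (e / 2)) as (d2 & p2 & h2); [lra|].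
exists (Rmin d1 d2); split; [now apply Rmin_pos|].
intros w hw. pose proof (Rmin_l d1 d2). pose proof (Rmin_r d1 d2).
specialize (h1 w ltac:(lra)). specialize (h2 w ltac:(lra)).
replace (f w + g w - (f z + g z))%C with ((f w - f z) + (g w - g z))%C by ring.
eapply Rle_lt_trans; [apply Cmod_triangle|lra].
Qed.

Lemma ccont_mult f g z : ccont f z -> ccont g z -> ccont (fun w => f w * g w)%C z.
Proof.
intros hf hg e he.
set (A := Cmod (f z) + Cmod (g z) + 1).
assert (hA : 0 < A) by (unfold A; pose proof (Cmod_ge_0 (f z)); pose proof (Cmod_ge_0 (g z)); lra).
set (m := Rmin 1 (e / A)).
assert (hm : 0 < m) by (apply Rmin_pos; [lra|now apply Rdiv_lt_0_compat]).
assert (hmA : m * A <= e).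
{ apply Rle_trans with (e / A * A); [apply Rmult_le_compat_r; [lra|apply Rmin_r]|].
  right; field; lra. }
assert (m1 : m <= 1) by apply Rmin_l.
destruct (hf m hm) as (d1 & p1 & h1). destruct (hg m hm) as (d2 & p2 & h2).
exists (Rmin d1 d2); split; [now apply Rmin_pos|].
intros w hw. pose proof (Rmin_l d1 d2). pose proof (Rmin_r d1 d2).
specialize (h1 w ltac:(lra)). specialize (h2 w ltac:(lra)).
replace (f w * g w - f z * g z)%C
  with ((f w - f z) * (g w - g z) + (f w - f z) * g z + f z * (g w - g z))%C by ring.
eapply Rle_lt_trans; [apply Cmod_triangle|].
eapply Rle_lt_trans; [apply Rplus_le_compat_r, Cmod_triangle|].
rewrite !Cmod_mult.
pose proof (Cmod_ge_0 (f z)); pose proof (Cmod_ge_0 (g z)).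
pose proof (Cmod_ge_0 (f w - f z)); pose proof (Cmod_ge_0 (g w - g z)).
unfold A in hmA.
assert (Cmod (f w - f z) * Cmod (g w - g z) < m * 1) by nra.
nra.
Qed.

Lemma ccont_comp f g z : ccont f z -> ccont g (f z) -> ccont (fun w => g (f w)) z.
Proof.
intros hf hg e he.
destruct (hg e he) as (d & p & h). destruct (hf d p) as (d' & p' & h').
exists d'; split; auto.
Qed.

Lemma ccont_inv f z : ccont f z -> f z <> 0%C -> ccont (fun w => / f w)%C z.
Proof.
intros hf hz e he.
set (a := Cmod (f z)). assert (ha : 0 < a) by now apply Cmod_gt_0.
assert (hm : 0 < Rmin (a / 2) (e * (a * a) / 2)).
{ apply Rmin_pos; [lra|]; repeat apply Rmult_lt_0_compat; lra. }
destruct (hf _ hm) as (d & p & h).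
exists d; split; auto. intros w hw; specialize (h w hw).
pose proof (Rmin_l (a / 2) (e * (a * a) / 2)). pose proof (Rmin_r (a / 2) (e * (a * a) / 2)).
assert (hw2 : a / 2 < Cmod (f w)).
{ pose proof (Cmod_minus_triangle_rev (f z) (f w)). rewrite Cmod_minus_sym in H1.
  fold a in H1. lra. }
assert (fw : f w <> 0%C) by (apply Cmod_gt_0; lra).
replace (/ f w - / f z)%C with (- ((f w - f z) * / (f w * f z)))%C by (field; auto).
rewrite Cmod_opp, Cmod_mult, Cmod_inv, Cmod_mult by (now apply Cmult_neq_0).
fold a. apply Rmult_lt_reg_r with (Cmod (f w) * a); [apply Rmult_lt_0_compat; lra|].
rewrite Rmult_assoc, Rinv_l, Rmult_1_r by (apply Rmult_integral_contrapositive; lra).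
assert (a / 2 * a <= Cmod (f w) * a) by (apply Rmult_le_compat_r; lra).
nra.
Qed.

(** Carathéodory's form of the derivative. It reduces the sum, product, chain and inverse rules to
    continuity and algebra, and later serves to divide out a zero. *)
Lemma cdiff_slope f z l : cdiff f z l ->
  exists q, ccont q z /\ q z = l /\ forall w, (f w = f z + q w * (w - z))%C.
Proof.
intros h.
exists (fun w => if Ceq_dec w z then l else ((f w - f z) / (w - z))%C).
destruct (Ceq_dec z z) as [_|]; [|contradiction].
assert (nz : forall w, w <> z -> (w - z)%C <> 0%C).
{ intros w hw e; apply hw. replace w with ((w - z) + z)%C by ring. rewrite e; ring. }
split; [|split; auto].
- intros e he. destruct (h (e / 2)) as (d & p & hd); [lra|].
  exists d; split; auto; intros w hw.
  destruct (Ceq_dec z z) as [_|]; [|contradiction].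
  destruct (Ceq_dec w z) as [->|hwz]; [rewrite Cmod_self; lra|].
  specialize (hd w hw). apply nz in hwz.
  replace ((f w - f z) / (w - z) - l)%C with ((f w - f z - l * (w - z)) / (w - z))%C
    by (field; auto).
  rewrite Cmod_div by auto. apply Cmod_gt_0 in hwz.
  apply Rle_lt_trans with (e / 2); [|lra]. apply Rle_div_l; auto.
- intros w; destruct (Ceq_dec w z) as [->|hwz]; [ring|].
  field; auto.
Qed.

Lemma cdiff_of_slope f z q d : 0 < d -> ccont q z ->
  (forall w, Cmod (w - z) < d -> (f w = f z + q w * (w - z))%C) -> cdiff f z (q z).
Proof.
intros hd hq hf e he. destruct (hq e he) as (d' & p & h).
exists (Rmin d d'); split; [now apply Rmin_pos|].
intros w hw. pose proof (Rmin_l d d'). pose proof (Rmin_r d d').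
rewrite (hf w) by lra.
replace (f z + q w * (w - z) - f z - q z * (w - z))%C with ((q w - q z) * (w - z))%C by ring.
rewrite Cmod_mult; apply Rmult_le_compat_r; [apply Cmod_ge_0|].
left; apply h; lra.
Qed.

Lemma cdiff_ccont f z l : cdiff f z l -> ccont f z.
Proof.
intros h; destruct (cdiff_slope f z l h) as (q & hq & _ & e).
assert (hc : ccont (fun w => f z + q w * (w + - z))%C z).
{ apply ccont_plus; [apply ccont_const|]; apply ccont_mult; auto.
  apply ccont_plus; [apply ccont_id|apply ccont_const]. }
intros eps heps; destruct (hc eps heps) as (d & p & hd); exists d; split; auto.
intros w hw; rewrite (e w). specialize (hd w hw).
replace (f z + q w * (w - z) - f z)%C
  with (f z + q w * (w + - z) - (f z + q z * (z + - z)))%C by ring. exact hd.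
Qed.

Lemma cdiff_ext f g z l d : 0 < d -> (forall w, Cmod (w - z) < d -> f w = g w) ->
  cdiff f z l -> cdiff g z l.
Proof.
intros hd he h e hp; destruct (h e hp) as (d' & p & h').
exists (Rmin d d'); split; [now apply Rmin_pos|].
intros w hw; pose proof (Rmin_l d d'); pose proof (Rmin_r d d').
rewrite <- (he w), <- (he z) by (rewrite ?Cmod_self; lra). apply h'; lra.
Qed.

Lemma cdiff_const c z : cdiff (fun _ => c) z 0.
Proof.
apply (cdiff_of_slope _ z (fun _ => RtoC 0) 1); [lra|apply ccont_const|intros; ring].
Qed.

Lemma cdiff_id z : cdiff (fun w => w) z 1.
Proof.
apply (cdiff_of_slope _ z (fun _ => RtoC 1) 1); [lra|apply ccont_const|intros; ring].
Qed.

Lemma cdiff_plus f g z a b : cdiff f z a -> cdiff g z b ->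
  cdiff (fun w => f w + g w)%C z (a + b)%C.
Proof.
intros hf hg; destruct (cdiff_slope _ _ _ hf) as (q & cq & <- & eq).
destruct (cdiff_slope _ _ _ hg) as (r & cr & <- & er).
apply (cdiff_of_slope _ z (fun w => q w + r w)%C 1); [lra|now apply ccont_plus|].
intros w _; rewrite (eq w), (er w); ring.
Qed.

Lemma cdiff_mult f g z a b : cdiff f z a -> cdiff g z b ->
  cdiff (fun w => f w * g w)%C z (a * g z + f z * b)%C.
Proof.
intros hf hg; pose proof (cdiff_ccont _ _ _ hg) as cg.
destruct (cdiff_slope _ _ _ hf) as (q & cq & <- & eq).
destruct (cdiff_slope _ _ _ hg) as (r & cr & <- & er).
apply (cdiff_of_slope _ z (fun w => q w * g w + f z * r w)%C 1); [lra| |].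
- apply ccont_plus; apply ccont_mult; auto; apply ccont_const.
- intros w _; rewrite (eq w), (er w); ring.
Qed.

Lemma cdiff_comp f g z a b : cdiff f z a -> cdiff g (f z) b ->
  cdiff (fun w => g (f w)) z (b * a)%C.
Proof.
intros hf hg; pose proof (cdiff_ccont _ _ _ hf) as cf.
destruct (cdiff_slope _ _ _ hf) as (q & cq & <- & eq).
destruct (cdiff_slope _ _ _ hg) as (r & cr & <- & er).
apply (cdiff_of_slope _ z (fun w => r (f w) * q w)%C 1); [lra| |].
- apply ccont_mult; auto. apply (ccont_comp f r); auto.
- intros w _; rewrite (er (f w)) at 1.
  replace (f w - f z)%C with (q w * (w - z))%C by (rewrite (eq w); ring). ring.
Qed.

Lemma cdiff_inv f z a : cdiff f z a -> f z <> 0%C ->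
  cdiff (fun w => / f w)%C z (- a * / (f z * f z))%C.
Proof.
intros hf hz; pose proof (cdiff_ccont _ _ _ hf) as cf.
destruct (cf (Cmod (f z))) as (d & p & hd); [now apply Cmod_gt_0|].
destruct (cdiff_slope _ _ _ hf) as (q & cq & <- & eq).
apply (cdiff_of_slope _ z (fun w => - q w * / (f w * f z))%C d); auto.
- apply ccont_mult.
  + intros e he; destruct (cq e he) as (d' & p' & h'); exists d'; split; auto.
    intros w hw; replace (- q w - - q z)%C with (- (q w - q z))%C by ring.
    rewrite Cmod_opp; auto.
  + apply ccont_inv; [|now apply Cmult_neq_0].
    apply ccont_mult; [auto|apply ccont_const].
- intros w hw. assert (fw : f w <> 0%C).
  { intros e; specialize (hd w hw). rewrite e in hd.
    replace (0 - f z)%C with (- f z)%C in hd by ring. rewrite Cmod_opp in hd; lra. }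
  assert (e : (q w * (w - z) = f w - f z)%C) by (rewrite (eq w); ring).
  replace (- q w * / (f w * f z) * (w - z))%C with (- (q w * (w - z)) * / (f w * f z))%C by ring.
  rewrite e; field; auto.
Qed.

(** * Real and imaginary parts as functions of two real variables *)

Lemma Rabs_Im_le (z : C) : Rabs (Im z) <= Cmod z.
Proof.
eapply Rle_trans; [|apply Rmax_Cmod]. apply Rmax_r.
Qed.

Lemma Cmod_lt_of_components (z : C) e :
  Rabs (Re z) < e -> Rabs (Im z) < e -> Cmod z < 2 * e.
Proof.
intros h1 h2. assert (e0 : 0 < e) by (pose proof (Rabs_pos (Re z)); lra).
apply Rsqr_incrst_0; [|apply Cmod_ge_0|lra].
unfold Rsqr. pose proof (Cmod2_alt z). apply Rabs_def2 in h1. apply Rabs_def2 in h2. nra.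
Qed.

Lemma ccont_continuity_2d (f : C -> C) (X Y : R -> R -> R) x y :
  ccont f (X x y, Y x y) -> continuity_2d_pt X x y -> continuity_2d_pt Y x y ->
  continuity_2d_pt (fun u v => Re (f (X u v, Y u v))) x y.
Proof.
intros hf hX hY eps.
destruct (hf eps (cond_pos eps)) as (d & p & hd).
assert (p2 : 0 < d / 2) by lra.
generalize (locally_2d_and _ _ _ _ (hX (mkposreal _ p2)) (hY (mkposreal _ p2))).
apply locally_2d_impl, locally_2d_forall; intros u v [h1 h2]; cbn in h1, h2.
eapply Rle_lt_trans; [|apply (hd (X u v, Y u v))].
- rewrite <- re_le_Cmod. apply Req_le; f_equal.
- replace d with (2 * (d / 2)) by field. apply Cmod_lt_of_components; [exact h1|exact h2].
Qed.

Lemma cdiff_Re f z l : cdiff f z l ->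
  differentiable_pt_lim (fun x y => Re (f (x, y))) (Re z) (Im z) (Re l) (- Im l).
Proof.
(* The half pays for passing from the modulus to the maximum of the coordinates: the factor [sqrt 2]
   is bounded by 2. *)
intros h eps. assert (he : 0 < eps / 2) by (pose proof (cond_pos eps); lra).
destruct (h _ he) as (d & p & hd).
assert (p2 : 0 < d / 2) by lra. exists (mkposreal _ p2); intros u v hu hv; cbn in hu, hv.
assert (hw : Cmod ((u, v) - z) < d).
{ replace d with (2 * (d / 2)) by field. apply Cmod_lt_of_components; [exact hu|exact hv]. }
specialize (hd (u, v) hw).
apply Rle_trans with (eps / 2 * Cmod ((u, v) - z)).
- eapply Rle_trans; [|exact hd]. eapply Rle_trans; [|apply re_le_Cmod].
  destruct z as [a b]; apply Req_le; f_equal; cring.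
- pose proof (Cmod_2Rmax ((u, v) - z)%C) as hm.
  assert (s2 : sqrt 2 <= 2) by (pose proof (sqrt_sqrt 2 ltac:(lra)); pose proof (sqrt_pos 2); nra).
  change (fst ((u, v) - z)%C) with (u - Re z) in hm.
  change (snd ((u, v) - z)%C) with (v - Im z) in hm.
  match type of hm with _ <= _ * ?M => set (m := M) in * end.
  match goal with |- _ <= _ * ?M => change M with m end.
  assert (0 <= m) by (eapply Rle_trans; [apply Rabs_pos|apply Rmax_l]).
  assert (Cmod ((u, v) - z) <= 2 * m) by nra.
  replace (eps * m) with (eps / 2 * (2 * m)) by field.
  apply Rmult_le_compat_l; lra.
Qed.

Lemma cdiff_Im f z l : cdiff f z l ->
  differentiable_pt_lim (fun x y => Im (f (x, y))) (Re z) (Im z) (Im l) (Re l).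
Proof.
intros h.
(* The imaginary part of [f] is the real part of [- Ci * f]. *)
assert (h' : cdiff (fun w => - Ci * f w)%C z (- Ci * l)%C).
{ replace (- Ci * l)%C with (0 * f z + - Ci * l)%C by ring.
  apply (cdiff_mult (fun _ => - Ci)%C f z 0 l); auto; apply cdiff_const. }
apply cdiff_Re in h'.
replace (Re (- Ci * l)) with (Im l) in h' by cring.
replace (- Im (- Ci * l)) with (Re l) in h' by cring.
revert h'; apply differentiable_pt_lim_ext, locally_2d_forall; intros u v; cring.
Qed.

Lemma differentiable_mult x y :
  differentiable_pt_lim (fun u v => u * v) x y y x.
Proof.
intros eps; exists eps; intros u v hu hv.
replace (u * v - x * y - (y * (u - x) + x * (v - y))) with ((u - x) * (v - y)) by ring.
rewrite Rabs_mult. apply Rmult_le_compat; try apply Rabs_pos; [lra|apply Rmax_r].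
Qed.

Lemma differentiable_fun_r f x y l : derivable_pt_lim f y l ->
  differentiable_pt_lim (fun _ v => f v) x y 0 l.
Proof.
intros h eps.
destruct (differentiable_pt_lim_proj1_0 f y x l h eps) as [d hd]. exists d; intros u v hu hv.
specialize (hd v u hv hu). rewrite Rmax_comm.
replace (f v - f y - (0 * (u - x) + l * (v - y)))
  with (f v - f y - (l * (v - y) + 0 * (u - x))) by ring. exact hd.
Qed.

Lemma differentiable_prod f g x y l m : derivable_pt_lim f x l -> derivable_pt_lim g y m ->
  differentiable_pt_lim (fun u v => f u * g v) x y (l * g y) (f x * m).
Proof.
intros hf hg.
replace (l * g y) with (g y * l + f x * 0) by ring.
replace (f x * m) with (g y * 0 + f x * m) by ring.
apply (differentiable_pt_lim_comp (fun u v => u * v) (fun u _ => f u) (fun _ v => g v)).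
- apply differentiable_mult.
- now apply differentiable_pt_lim_proj1_0.
- now apply differentiable_fun_r.
Qed.

(** * The mean value property *)

Definition polar (r t : R) : C := (r * cos t, r * sin t).

Lemma Cmod_polar r t : Cmod (polar r t) = Rabs r.
Proof.
unfold Cmod, polar; cbn [fst snd].
replace ((r * cos t) ^ 2 + (r * sin t) ^ 2) with (Rsqr r).
- apply sqrt_Rsqr_abs.
- pose proof (sin2_cos2 t); unfold Rsqr in *.
  replace ((r * cos t) ^ 2 + (r * sin t) ^ 2)
    with (r * r * (sin t * sin t + cos t * cos t)) by ring. rewrite H; ring.
Qed.

Lemma continuity_2d_section (g : R -> R -> R) x y :
  continuity_2d_pt g x y -> continuity_pt (fun v => g x v) y.
Proof.
intros h. apply continuity_pt_locally; intros eps. destruct (h eps) as [d hd].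
exists d; intros v hv; apply hd; auto. rewrite Rminus_diag, Rabs_R0; apply cond_pos.
Qed.

Lemma polar_continuity_2d f r t : ccont f (polar r t) ->
  continuity_2d_pt (fun u v => Re (f (polar u v))) r t.
Proof.
intros hf. apply (ccont_continuity_2d f (fun u v => u * cos v) (fun u v => u * sin v)); auto.
- apply differentiable_continuity_pt; exists (1 * cos t), (r * - sin t).
  apply (differentiable_prod (fun u => u) cos);
  [apply derivable_pt_lim_id|apply derivable_pt_lim_cos].
- apply differentiable_continuity_pt; exists (1 * sin t), (r * cos t).
  apply (differentiable_prod (fun u => u) sin);
  [apply derivable_pt_lim_id|apply derivable_pt_lim_sin].
Qed.

(** Not divided by 2 PI, and restricted to the real part; a unimodular factor later recovers the
    modulus. *)
Definition circle_mean (f : C -> C) (r : R) : R :=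
  RInt (fun t => Re (f (polar r t))) 0 (2 * PI).

Lemma two_pi_pos : 0 < 2 * PI.
Proof. pose proof PI_RGT_0; lra. Qed.

(* Cauchy--Goursat for f(exp(x + i y)) on [ln r1, ln r2] x [0, 2 PI]: the horizontal
   sides cancel by periodicity. *)
Lemma circle_mean_annulus f r1 r2 :
  0 < r1 < r2 -> (forall z, r1 <= Cmod z <= r2 -> exists l, cdiff f z l) ->
  circle_mean f r1 = circle_mean f r2.
Proof.
intros hr hf.
set (U := fun x y => Re (f (polar (exp x) y))).
set (V := fun x y => Im (f (polar (exp x) y))).
assert (hl : ln r1 <= ln r2) by (left; apply ln_increasing; lra).
(* V dx + U dy is the imaginary part of f(exp z) dz, closed by the Cauchy--Riemann equations. On the
   vertical sides it integrates to the two circle means. *)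
assert (G : circulation V U (ln r1) 0 (ln r2 - ln r1) (2 * PI - 0) = 0).
{ apply goursat_rectangle; [exact hl|left; apply two_pi_pos|].
  intros x y hx hy.
  destruct (hf (polar (exp x) y)) as [l hl'].
  { rewrite Cmod_polar, Rabs_pos_eq by (left; apply exp_pos).
    rewrite <- (exp_ln r1), <- (exp_ln r2) by lra. split.
    - destruct hx as [[h| ->] _]; [left; now apply exp_increasing|lra].
    - destruct hx as [_ [h| ->]]; [left; now apply exp_increasing|lra]. }
  pose proof (differentiable_prod exp cos x y _ _ (derivable_pt_lim_exp x) (derivable_pt_lim_cos y)) as hc.
  pose proof (differentiable_prod exp sin x y _ _ (derivable_pt_lim_exp x) (derivable_pt_lim_sin y)) as hs.
  set (p := Re l). set (q := Im l). set (c := exp x * cos y). set (s := exp x * sin y).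
  exists (q * c + p * s), (q * (exp x * - sin y) + p * c), (p * (exp x * - sin y) + (- q) * c).
  split.
  - apply (differentiable_pt_lim_comp (fun x y => Im (f (x, y)))
      (fun x y => exp x * cos y) (fun x y => exp x * sin y)); auto.
    apply (cdiff_Im _ _ _ hl').
  - replace (q * (exp x * - sin y) + p * c) with (p * c + (- q) * s) by (unfold c, s; ring).
    apply (differentiable_pt_lim_comp (fun x y => Re (f (x, y)))
      (fun x y => exp x * cos y) (fun x y => exp x * sin y)); auto.
    apply (cdiff_Re _ _ _ hl'). }
assert (hc : forall r, r1 <= r <= r2 -> forall t, continuity_pt (fun t => Re (f (polar r t))) t).
{ intros r h t. destruct (hf (polar r t)) as [l hl'].
  { rewrite Cmod_polar, Rabs_pos_eq; lra. }
  apply (continuity_2d_section (fun u v => Re (f (polar u v))) r t).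
  apply polar_continuity_2d; eapply cdiff_ccont; exact hl'. }
unfold circulation in G.
replace (ln r1 + (ln r2 - ln r1)) with (ln r2) in G by ring.
rewrite Rminus_0_r, Rplus_0_l in G.
rewrite (RInt_ext _ (fun _ => 0)) in G.
2:{ intros t _. apply Rminus_diag_eq. unfold V, polar. now rewrite cos_2PI, sin_2PI, cos_0, sin_0. }
rewrite RInt_const in G.
rewrite (RInt_minus (V := R_CompleteNormedModule)) in G.
- unfold U in G. rewrite !exp_ln in G by lra. unfold circle_mean.
  unfold minus, plus, opp, scal in G; simpl in G; unfold mult in G; simpl in G. lra.
- apply ex_RInt_continuous_on; [left; apply two_pi_pos|]. intros; unfold U; rewrite exp_ln by lra; apply hc; lra.
- apply ex_RInt_continuous_on; [left; apply two_pi_pos|]. intros; unfold U; rewrite exp_ln by lra; apply hc; lra.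
Qed.

(** The integrand is jointly continuous, hence uniformly so over the compact interval of angles. The
    case [r = 0] is included and links the means to the value at the centre. *)
Lemma circle_mean_continuous f r :
  (exists d, 0 < d /\ forall z, Rabs (Cmod z - Rabs r) < d -> ccont f z) ->
  continuity_pt (circle_mean f) r.
Proof.
intros [d0 [p0 hd0]].
assert (hf : forall z, Cmod z = Rabs r -> ccont f z).
{ intros z hz; apply hd0. rewrite hz, Rminus_diag, Rabs_R0; auto. }
 pose proof two_pi_pos as pp.
apply continuity_pt_locally; intros eps.
assert (he : 0 < eps / (2 * (2 * PI))) by (pose proof (cond_pos eps); apply Rdiv_lt_0_compat; lra).
destruct (uniform_continuity_2d_1d' (fun u v => Re (f (polar u v))) 0 (2 * PI) r) with
  (eps := mkposreal _ he) as [d hd].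
{ intros t _; apply polar_continuity_2d, hf, Cmod_polar. }
assert (pm : 0 < Rmin d d0) by (apply Rmin_pos; [apply cond_pos|auto]).
exists (mkposreal _ pm); intros r' hr'; cbn in hr'. change (Rabs (r' - r) < Rmin d d0) in hr'.
pose proof (Rmin_l d d0). pose proof (Rmin_r d d0).
assert (c1 : forall t, continuity_pt (fun t => Re (f (polar r t))) t).
{ intros t; apply (continuity_2d_section (fun u v => Re (f (polar u v)))).
  apply polar_continuity_2d, hf, Cmod_polar. }
assert (c2 : forall t, continuity_pt (fun t => Re (f (polar r' t))) t).
{ intros t; apply (continuity_2d_section (fun u v => Re (f (polar u v)))).
  apply polar_continuity_2d, hd0. rewrite Cmod_polar.
  eapply Rle_lt_trans; [apply Rabs_triang_inv2|lra]. }
unfold circle_mean.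
replace (RInt (fun t => Re (f (polar r' t))) 0 (2 * PI)
   - RInt (fun t => Re (f (polar r t))) 0 (2 * PI))
  with (RInt (fun t => Re (f (polar r' t)) - Re (f (polar r t))) 0 (2 * PI)).
2:{ apply (RInt_minus (V := R_CompleteNormedModule));
    apply ex_RInt_continuous_on; auto; lra. }
eapply Rle_lt_trans; [apply Rabs_RInt_le with (M := eps / (2 * (2 * PI)))|].
- lra.
- intros t _; apply continuity_pt_minus; auto.
- intros t ht. left. apply Rabs_def2 in hr'. apply hd; try lra.
  rewrite Rminus_diag, Rabs_R0; apply cond_pos.
- pose proof (cond_pos eps). replace ((2 * PI - 0) * (eps / (2 * (2 * PI)))) with (eps / 2) by (field; lra). lra.
Qed.

(** The annulus argument applies only strictly between radii at which it may fail, namely 0 and the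
    radius of the exceptional point; continuity closes the gap. *)
Lemma constant_to_endpoints (M : R -> R) a b : a < b ->
  continuity_pt M a -> continuity_pt M b ->
  (forall x y, a < x < y -> y < b -> M x = M y) -> M a = M b.
Proof.
intros hab ca cb hM. apply Rminus_diag_uniq.
assert (h : forall e, 0 < e -> Rabs (M a - M b) < e).
{ intros e he. assert (he2 : 0 < e / 2) by lra.
  destruct (proj1 (continuity_pt_locally M a) ca (mkposreal _ he2)) as [d1 h1].
  destruct (proj1 (continuity_pt_locally M b) cb (mkposreal _ he2)) as [d2 h2].
  pose proof (cond_pos d1); pose proof (cond_pos d2).
  set (m := Rmin ((b - a) / 3) (Rmin d1 d2 / 2)).
  assert (m0 : 0 < m) by (apply Rmin_pos; [lra|]; pose proof (Rmin_pos d1 d2 H H0); lra).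
  assert (m1 : m <= (b - a) / 3) by apply Rmin_l.
  assert (m2 : m <= Rmin d1 d2 / 2) by apply Rmin_r.
  pose proof (Rmin_l d1 d2). pose proof (Rmin_r d1 d2).
  specialize (h1 (a + m)). specialize (h2 (b - m)).
  change (Rabs (a + m - a) < d1 -> Rabs (M (a + m) - M a) < e / 2) in h1.
  change (Rabs (b - m - b) < d2 -> Rabs (M (b - m) - M b) < e / 2) in h2.
  rewrite (hM (a + m) (b - m)) in h1 by lra.
  assert (g1 := h1 ltac:(apply Rabs_def1; lra)).
  assert (g2 := h2 ltac:(apply Rabs_def1; lra)).
  apply Rabs_def2 in g1; apply Rabs_def2 in g2; apply Rabs_def1; lra. }
destruct (Req_dec (M a - M b) 0) as [|n]; auto.
apply Rabs_pos_lt in n. specialize (h _ n); lra.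
Qed.

(* On both sides of the exceptional circle |z| = |p| the mean is constant, and it is
   continuous across it, so the singularity at p need not be removed. *)
Lemma mean_value f p rad r : 0 < r < rad ->
  (forall z, Cmod z < rad -> ccont f z) ->
  (forall z, 0 < Cmod z < rad -> z <> p -> exists l, cdiff f z l) ->
  circle_mean f r = 2 * PI * Re (f 0).
Proof.
intros hr hc hd.
assert (cm : forall s, 0 <= s < rad -> continuity_pt (circle_mean f) s).
{ intros s hs; rewrite <- (Rabs_pos_eq s) in hs by lra. apply circle_mean_continuous.
  exists (rad - Rabs s); split; [lra|].
  intros z hz; apply hc; apply Rabs_def2 in hz; lra. }
assert (flat : forall a b, 0 <= a < b -> b < rad -> (Cmod p <= a \/ b <= Cmod p) ->
   circle_mean f a = circle_mean f b).
{ intros a b h1 h2 h3; apply constant_to_endpoints; [lra|apply cm; lra|apply cm; lra|].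
  intros x y hx hy; apply circle_mean_annulus; [lra|].
  intros z hz; apply hd; [lra|]. intros ->; lra. }
(* On the circle of radius 0 the integrand is the constant [Re (f 0)]. If [Cmod p] lies strictly
   between 0 and [r], the passage is made in two pieces. *)
transitivity (circle_mean f 0).
- symmetry. pose proof (Cmod_ge_0 p).
  destruct (Rle_dec r (Cmod p)) as [h|h]; [apply flat; lra|].
  destruct (Req_dec (Cmod p) 0) as [e|e]; [apply flat; lra|].
  rewrite (flat 0 (Cmod p)), (flat (Cmod p) r); lra.
- unfold circle_mean. rewrite (RInt_ext _ (fun _ => Re (f 0))).
  + rewrite RInt_const. unfold scal; simpl; unfold mult; simpl; ring.
  + intros t _; f_equal; f_equal; unfold polar; now rewrite !Rmult_0_l.
Qed.

(** The rotation taking [z] to the positive axis. It converts estimates of real parts, which circle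
    means and the real mean value theorem provide, into estimates of the modulus. *)
Lemma exists_unimodular (z : C) : exists c, Cmod c = 1 /\ Re (c * z) = Cmod z.
Proof.
destruct (Ceq_dec z 0) as [->|hz].
- exists 1%C; rewrite Cmod_1, Cmod_0; split; [auto|cring].
- assert (h : 0 < Cmod z) by now apply Cmod_gt_0.
  assert (nz : RtoC (Cmod z) <> 0%C) by (intros e; apply RtoC_inj in e; lra).
  exists (Cconj z / RtoC (Cmod z))%C; split.
  + rewrite Cmod_div, Cmod_conj, Cmod_R, Rabs_pos_eq by (auto; lra). field; lra.
  + replace (Cconj z / RtoC (Cmod z) * z)%C with (RtoC (Cmod z)); [reflexivity|].
    transitivity ((z * Cconj z) / RtoC (Cmod z))%C; [|field; auto].
    rewrite <- Cmod2_conj. replace (Cmod z ^ 2) with (Cmod z * Cmod z) by ring.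
    rewrite RtoC_mult; field; auto.
Qed.

(** The rotated value at 0 is an average over the circle. A bound at the centre suffices, since a
    disc automorphism can bring any point there. *)
Lemma maximum_at_center f p rad r K : 0 < r < rad ->
  (forall z, Cmod z < rad -> ccont f z) ->
  (forall z, 0 < Cmod z < rad -> z <> p -> exists l, cdiff f z l) ->
  (forall z, Cmod z = r -> Cmod (f z) <= K) -> Cmod (f 0) <= K.
Proof.
intros hr hc hd hK. destruct (exists_unimodular (f 0)) as (c & c1 & c2).
assert (cc : forall z, Cmod z < rad -> ccont (fun w => c * f w)%C z).
{ intros z hz; apply ccont_mult; [apply ccont_const|auto]. }
assert (hm : circle_mean (fun w => c * f w)%C r = 2 * PI * Re (c * f 0)%C).
{ apply (mean_value (fun w => c * f w)%C p rad); auto.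
  intros z hz hp; destruct (hd z hz hp) as [l hl]. eexists.
  apply (cdiff_mult (fun _ => c)); [apply cdiff_const|exact hl]. }
assert (hb : Rabs (circle_mean (fun w => c * f w)%C r) <= (2 * PI - 0) * K).
{ pose proof two_pi_pos; apply Rabs_RInt_le; [lra| |].
  - intros t _. apply (continuity_2d_section (fun u v => Re (c * f (polar u v))%C)).
    apply (polar_continuity_2d (fun w => c * f w)%C), cc. rewrite Cmod_polar, Rabs_pos_eq; lra.
  - intros t _. eapply Rle_trans; [apply re_le_Cmod|].
    rewrite Cmod_mult, c1, Rmult_1_l. apply hK. rewrite Cmod_polar, Rabs_pos_eq; lra. }
rewrite hm, c2 in hb. apply Rabs_le_between in hb. pose proof two_pi_pos.
apply Rmult_le_reg_l with (2 * PI); lra.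
Qed.

(** * The Schwarz--Pick lemma *)

Lemma blaschke_identity (a z : C) :
  Cmod (1 - Cconj a * z) ^ 2 = Cmod (z - a) ^ 2 + (1 - Cmod a ^ 2) * (1 - Cmod z ^ 2).
Proof. rewrite !Cmod2_alt; cring. Qed.

Lemma blaschke_denominator (a z : C) : Cmod a < 1 -> Cmod z <= 1 ->
  (1 - Cconj a * z)%C <> 0%C.
Proof.
intros ha hz. apply Cmod_gt_0.
pose proof (Cmod_minus_triangle_rev 1 (Cconj a * z)) as h.
rewrite Cmod_1, Cmod_mult, Cmod_conj in h.
pose proof (Cmod_ge_0 a); pose proof (Cmod_ge_0 z); nra.
Qed.

Lemma blaschke_le (a z : C) : Cmod a < 1 -> Cmod z <= 1 ->
  Cmod (z - a) <= Cmod (1 - Cconj a * z).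
Proof.
intros ha hz. pose proof (blaschke_identity a z).
pose proof (Cmod_ge_0 a); pose proof (Cmod_ge_0 z).
pose proof (Cmod_ge_0 (z - a)); pose proof (Cmod_ge_0 (1 - Cconj a * z)).
assert (0 <= (1 - Cmod a ^ 2) * (1 - Cmod z ^ 2)) by (apply Rmult_le_pos; nra).
nra.
Qed.

Lemma blaschke_lt (a z : C) : Cmod a < 1 -> Cmod z < 1 ->
  Cmod (z - a) < Cmod (1 - Cconj a * z).
Proof.
intros ha hz. pose proof (blaschke_identity a z).
pose proof (Cmod_ge_0 a); pose proof (Cmod_ge_0 z).
pose proof (Cmod_ge_0 (z - a)); pose proof (Cmod_ge_0 (1 - Cconj a * z)).
assert (0 < (1 - Cmod a ^ 2) * (1 - Cmod z ^ 2)) by (apply Rmult_lt_0_compat; nra).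
nra.
Qed.

Lemma cdiff_affine a b z : cdiff (fun w => a + b * w)%C z b.
Proof.
apply (cdiff_of_slope _ z (fun _ => b) 1); [lra|apply ccont_const|intros; ring].
Qed.

(* The maximum principle is applied to u / tau, where tau is the disc automorphism with
   tau 0 = z0 and u is f o tau followed by the automorphism sending f 0 to 0; both
   vanish at - z0. *)
Lemma schwarz_pick f z0 :
  (forall z, Cmod z < 1 -> exists l, cdiff f z l) ->
  (forall z, Cmod z < 1 -> Cmod (f z) <= 1) -> Cmod (f 0) < 1 -> Cmod z0 < 1 ->
  Cmod (f z0 - f 0) <= Cmod z0 * Cmod (1 - Cconj (f 0) * f z0).
Proof.
intros hd hb ha hz0.
destruct (Ceq_dec z0 0) as [->|nz0]; [rewrite Cmod_self, Cmod_0; lra|].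
apply Cmod_gt_0 in nz0.
set (a := f 0) in *.
set (tau := fun w => ((z0 + 1 * w) * / (1 + Cconj z0 * w))%C).
assert (den : forall w, Cmod w < 1 -> (1 + Cconj z0 * w)%C <> 0%C).
{ intros w hw. replace (1 + Cconj z0 * w)%C with (1 - Cconj (- z0) * w)%C.
  - apply blaschke_denominator; [rewrite Cmod_opp|]; lra.
  - rewrite Copp_conj; ring. }
assert (id : forall w, Cmod (1 + Cconj z0 * w) ^ 2 =
   Cmod (z0 + 1 * w) ^ 2 + (1 - Cmod z0 ^ 2) * (1 - Cmod w ^ 2)).
{ intros w. pose proof (blaschke_identity (- z0) w) as h.
  rewrite Cmod_opp in h. rewrite Copp_conj in h.
  replace (1 - - Cconj z0 * w)%C with (1 + Cconj z0 * w)%C in h by ring.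
  replace (w - - z0)%C with (z0 + 1 * w)%C in h by ring. exact h. }
assert (tau1 : forall w, Cmod w < 1 -> Cmod (tau w) < 1).
{ intros w hw. unfold tau. pose proof (den w hw) as dw.
  rewrite Cmod_mult, Cmod_inv by auto. apply Cmod_gt_0 in dw.
  apply Rmult_lt_reg_r with (Cmod (1 + Cconj z0 * w)); auto.
  rewrite Rmult_assoc, Rinv_l, Rmult_1_r, Rmult_1_l by lra.
  specialize (id w). pose proof (Cmod_ge_0 w). pose proof (Cmod_ge_0 (z0 + 1 * w)).
  assert (0 < (1 - Cmod z0 ^ 2) * (1 - Cmod w ^ 2)) by (apply Rmult_lt_0_compat; nra).
  nra. }
set (u := fun w => ((- a + 1 * f (tau w)) * / (1 + - Cconj a * f (tau w)))%C).
assert (fden : forall z, Cmod z < 1 -> (1 + - Cconj a * f z)%C <> 0%C).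
{ intros z hz. replace (1 + - Cconj a * f z)%C with (1 - Cconj a * f z)%C by ring.
  apply blaschke_denominator; auto. }
assert (u1 : forall w, Cmod w < 1 -> Cmod (u w) <= 1).
{ intros w hw. unfold u. pose proof (fden _ (tau1 w hw)) as dw.
  rewrite Cmod_mult, Cmod_inv by auto. apply Cmod_gt_0 in dw.
  apply Rmult_le_reg_r with (Cmod (1 + - Cconj a * f (tau w))); auto.
  rewrite Rmult_assoc, Rinv_l, Rmult_1_r, Rmult_1_l by lra.
  replace (- a + 1 * f (tau w))%C with (f (tau w) - a)%C by ring.
  replace (1 + - Cconj a * f (tau w))%C with (1 - Cconj a * f (tau w))%C by ring.
  apply blaschke_le; auto. }
assert (ud : forall w, Cmod w < 1 -> exists l, cdiff u w l).
{ intros w hw. destruct (hd _ (tau1 w hw)) as [l hl].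
  assert (td : exists t, cdiff tau w t).
  { eexists; unfold tau. apply (cdiff_mult (fun w => z0 + 1 * w)%C).
    - apply cdiff_affine.
    - apply cdiff_inv; [apply cdiff_affine|auto]. }
  destruct td as [t ht]. pose proof (cdiff_comp tau f w t l ht hl) as hc.
  eexists; unfold u. apply (cdiff_mult (fun w => - a + 1 * f (tau w))%C).
  - apply (cdiff_comp (fun w => f (tau w)) (fun y => - a + 1 * y)%C); [exact hc|apply cdiff_affine].
  - apply cdiff_inv; [|auto].
    apply (cdiff_comp (fun w => f (tau w)) (fun y => 1 + - Cconj a * y)%C);
    [exact hc|apply cdiff_affine]. }
assert (mz : Cmod (- z0) < 1) by (rewrite Cmod_opp; auto).
destruct (ud (- z0)%C mz) as [l hl].
(* As [u] vanishes at [- z0], its slope there is the quotient of [u] by [z0 + w]. It is known to be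
   continuous at [- z0] but not differentiable there, which is the exceptional point that the mean
   value property tolerates. *)
destruct (cdiff_slope _ _ _ hl) as (s & cs & _ & hs).
assert (u0 : u (- z0)%C = 0%C).
{ unfold u. replace (tau (- z0)%C) with (RtoC 0).
  - fold a; ring.
  - unfold tau; ring. }
assert (hs' : forall w, u w = (s w * (z0 + 1 * w))%C).
{ intros w; rewrite (hs w), u0; ring. }
assert (sd : forall w, Cmod w < 1 -> w <> (- z0)%C -> exists k, cdiff s w k).
{ intros w hw hne.
  assert (nz : (z0 + 1 * w)%C <> 0%C).
  { intros e; apply hne. replace w with ((z0 + 1 * w) - z0)%C by ring. rewrite e; ring. }
  destruct (ud w hw) as [m hm]. eexists.
  apply (cdiff_ext (fun w => u w * / (z0 + 1 * w))%C s w _ (Cmod (z0 + 1 * w))).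
  - now apply Cmod_gt_0.
  - intros v hv. rewrite hs'.
    assert (nv : (z0 + 1 * v)%C <> 0%C).
    { intros e. replace (v - w)%C with ((z0 + 1 * v) - (z0 + 1 * w))%C in hv by ring.
      rewrite e in hv. replace (0 - (z0 + 1 * w))%C with (- (z0 + 1 * w))%C in hv by ring.
      rewrite Cmod_opp in hv; lra. }
    field. intros e; apply nv; rewrite <- e; ring.
  - apply cdiff_mult; [exact hm|]. apply cdiff_inv; [apply cdiff_affine|auto]. }
(* This is u / tau with the zero at [- z0] already divided out; [q 0 = s 0]. *)
set (q := fun w => (s w * (1 + Cconj z0 * w))%C).
assert (sc : forall w, Cmod w < 1 -> ccont s w).
{ intros w hw. destruct (Ceq_dec w (- z0)%C) as [->|n]; auto.
  destruct (sd w hw n) as [k hk]; eapply cdiff_ccont; eauto. }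
assert (hq : Cmod (s 0) <= 1).
{ set (kap := (1 - Cmod z0) / 2). assert (k0 : 0 < kap) by (unfold kap; lra).
  (* On |w| = r the point [- z0] is at distance at least [kap], so [id] bounds 1 / |tau| by
     [1 + (1 - r ^ 2) / kap ^ 2]. The excess tends to 0 as r tends to 1, which replaces boundary
     values on the unit circle. *)
  assert (bnd : forall r, Cmod z0 + kap <= r < 1 -> Cmod (s 0) <= 1 + (1 - r ^ 2) / kap ^ 2).
  { intros r hr. replace (s 0) with (q 0) by (unfold q; ring).
    apply (maximum_at_center q (- z0)%C 1 r); [lra| | |].
    - intros z hz; unfold q. apply ccont_mult; auto.
      eapply cdiff_ccont; apply cdiff_affine.
    - intros z hz hp. destruct (sd z ltac:(lra) hp) as [k hk].
      eexists; unfold q; apply cdiff_mult; [exact hk|apply cdiff_affine].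
    - intros w hw. pose proof (u1 w ltac:(lra)) as hu. rewrite hs', Cmod_mult in hu.
      unfold q; rewrite Cmod_mult. specialize (id w).
      assert (low : kap <= Cmod (z0 + 1 * w)).
      { pose proof (Cmod_minus_triangle_rev (1 * w) (- z0)) as h.
        rewrite Cmod_opp, Cmod_mult, Cmod_1 in h.
        replace (1 * w - - z0)%C with (z0 + 1 * w)%C in h by ring. lra. }
      rewrite hw in id.
      set (A := Cmod (1 + Cconj z0 * w)) in *. set (B := Cmod (z0 + 1 * w)) in *.
      assert (hA : 0 <= A) by apply Cmod_ge_0. assert (hS := Cmod_ge_0 (s w)).
      set (S := Cmod (s w)) in *.
      set (x := (1 - r ^ 2) / kap ^ 2).
      assert (k2 : 0 < kap ^ 2) by nra.
      assert (r2 : 0 <= 1 - r ^ 2) by (pose proof (Cmod_ge_0 z0); nra).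
      assert (x0 : 0 <= x) by (apply Rdiv_le_0_compat; auto).
      assert (xk : 1 - r ^ 2 = x * kap ^ 2) by (unfold x; field; lra).
      assert (A2 : A ^ 2 <= B ^ 2 * (1 + x)).
      { assert ((1 - Cmod z0 ^ 2) * (1 - r ^ 2) <= 1 * (1 - r ^ 2)).
        { apply Rmult_le_compat_r; auto; pose proof (pow2_ge_0 (Cmod z0)); lra. }
        assert (x * kap ^ 2 <= x * B ^ 2) by (apply Rmult_le_compat_l; nra). lra. }
      assert (A3 : A <= B * (1 + x)).
      { apply Rsqr_incr_0_var; [|apply Rmult_le_pos; lra]. unfold Rsqr.
        assert (B ^ 2 * (1 + x) * 1 <= B ^ 2 * (1 + x) * (1 + x)) by
          (apply Rmult_le_compat_l; [apply Rmult_le_pos; nra|lra]). nra. }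
      apply Rle_trans with (S * (B * (1 + x))); [apply Rmult_le_compat_l; auto|].
      rewrite <- Rmult_assoc. apply Rle_trans with (1 * (1 + x)); [|lra].
      apply Rmult_le_compat_r; lra. }
  apply Rnot_lt_le; intros hlt.
  set (D := Cmod (s 0) - 1). assert (D0 : 0 < D) by (unfold D; lra).
  assert (k2 : 0 < kap ^ 2) by nra. assert (P := Rmult_lt_0_compat _ _ D0 k2).
  (* With 1 - r at most [D * kap ^ 2 / 4], the excess is at most 2 (1 - r) / kap^2, hence at most
     [D / 2]. *)
  set (r := Rmax (Cmod z0 + kap) (1 - D * kap ^ 2 / 4)).
  assert (r1 : Cmod z0 + kap <= r) by apply Rmax_l.
  assert (r2 : 1 - D * kap ^ 2 / 4 <= r) by apply Rmax_r.
  assert (r3 : r < 1) by (apply Rmax_lub_lt; unfold kap in *; lra).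
  specialize (bnd r (conj r1 r3)).
  assert ((1 - r ^ 2) / kap ^ 2 <= D / 2).
  { apply Rle_div_l; auto. nra. }
  unfold D in *; lra. }
specialize (hs' 0%C).
assert (t0 : tau 0%C = z0).
{ unfold tau. replace (1 + Cconj z0 * 0)%C with (RtoC 1) by ring.
  replace (/ RtoC 1)%C with (RtoC 1) by (rewrite <- RtoC_inv by lra; f_equal; field). ring. }
unfold u in hs'; rewrite t0 in hs'.
pose proof (fden z0 hz0) as dz.
replace (1 - Cconj a * f z0)%C with (1 + - Cconj a * f z0)%C by ring.
assert (e : (f z0 - a = s 0 * z0 * (1 + - Cconj a * f z0))%C).
{ transitivity ((- a + 1 * f z0) * / (1 + - Cconj a * f z0) * (1 + - Cconj a * f z0))%C.
  - field. intros e; apply dz; rewrite <- e; ring.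
  - rewrite hs'; ring. }
rewrite e, !Cmod_mult. apply Rmult_le_compat_r; [apply Cmod_ge_0|].
pose proof (Cmod_ge_0 z0). nra.
Qed.

(** * Mean value estimates along segments *)

Lemma cdiff_line f z d t l : cdiff f (z + RtoC t * d) l ->
  is_derive (fun t => Re (f (z + RtoC t * d)%C)) t (Re (l * d)).
Proof.
intros h. apply is_derive_Reals. intros e he.
set (D := Cmod d + 1). assert (D0 : 0 < D) by (unfold D; pose proof (Cmod_ge_0 d); lra).
assert (heD : 0 < e / (2 * D)) by (apply Rdiv_lt_0_compat; lra).
destruct (h _ heD) as (del & p & hd).
assert (pd : 0 < del / D) by now apply Rdiv_lt_0_compat.
exists (mkposreal _ pd). intros s hs0 hs; cbn in hs.
assert (as0 : 0 < Rabs s) by now apply Rabs_pos_lt.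
set (w := (z + RtoC t * d)%C) in *.
replace (z + RtoC (t + s) * d)%C with (w + RtoC s * d)%C by (unfold w; rewrite RtoC_plus; ring).
assert (hm : Cmod (w + RtoC s * d - w) = Rabs s * Cmod d).
{ replace (w + RtoC s * d - w)%C with (RtoC s * d)%C by ring. now rewrite Cmod_mult, Cmod_R. }
pose proof (Cmod_ge_0 d) as d0.
assert (hsd : Rabs s * D < del) by (apply Rlt_div_r; auto).
specialize (hd (w + RtoC s * d)%C). rewrite hm in hd.
specialize (hd ltac:(unfold D in hsd; nra)).
pose proof (re_le_Cmod (f (w + RtoC s * d) - f w - l * (w + RtoC s * d - w))%C) as hr.
replace (Re (f (w + RtoC s * d) - f w - l * (w + RtoC s * d - w))%C)
  with (Re (f (w + RtoC s * d)%C) - Re (f w) - s * Re (l * d)) in hr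
  by (replace (w + RtoC s * d - w)%C with (RtoC s * d)%C by ring; cring).
replace ((Re (f (w + RtoC s * d)%C) - Re (f w)) / s - Re (l * d))
  with ((Re (f (w + RtoC s * d)%C) - Re (f w) - s * Re (l * d)) / s) by (field; auto).
rewrite Rabs_div by auto.
apply Rle_lt_trans with (e / 2); [|lra]. apply Rle_div_l; auto.
eapply Rle_trans; [exact hr|]. eapply Rle_trans; [exact hd|].
assert (e / (2 * D) * (Rabs s * D) = e / 2 * Rabs s) by (field; lra).
assert (e / (2 * D) * (Rabs s * Cmod d) <= e / (2 * D) * (Rabs s * D)).
{ apply Rmult_le_compat_l; [lra|]; apply Rmult_le_compat_l; unfold D; lra. }
lra.
Qed.

Lemma Cmod_segment z w t : 0 <= t <= 1 ->
  Cmod (w + RtoC t * (z - w)) <= (1 - t) * Cmod w + t * Cmod z.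
Proof.
intros ht. replace (w + RtoC t * (z - w))%C with (RtoC (1 - t) * w + RtoC t * z)%C
  by (rewrite RtoC_minus; ring).
eapply Rle_trans; [apply Cmod_triangle|].
rewrite !Cmod_mult, !Cmod_R, !Rabs_pos_eq; lra.
Qed.

Lemma Cmod_segment_le z w t s : 0 <= t <= 1 -> Cmod z <= s -> Cmod w <= s ->
  Cmod (w + RtoC t * (z - w)) <= s.
Proof. intros ht hz hw; pose proof (Cmod_segment z w t ht). nra. Qed.

(** An exact intermediate point exists for real-valued functions, hence the real part; callers first
    multiply [f] by the constant whose direction matters. *)
Lemma mean_value_segment f f' w d :
  (forall t, 0 <= t <= 1 -> cdiff f (w + RtoC t * d) (f' (w + RtoC t * d)%C)) ->
  exists t, 0 <= t <= 1 /\ Re (f (w + d)%C) - Re (f w) = Re (f' (w + RtoC t * d) * d)%C.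
Proof.
intros h.
destruct (MVT_gen (fun t => Re (f (w + RtoC t * d)%C)) 0 1
  (fun t => Re (f' (w + RtoC t * d)%C * d))) as (t & ht & e).
- rewrite Rmin_left, Rmax_right by lra. intros t ht; apply cdiff_line, h; lra.
- rewrite Rmin_left, Rmax_right by lra. intros t ht.
  apply continuity_pt_filterlim, (ex_derive_continuous (K := R_AbsRing) (V := R_NormedModule)).
  eexists; apply cdiff_line, h; lra.
- rewrite Rmin_left, Rmax_right in ht by lra. exists t; split; auto.
  replace (w + 1 * d)%C with (w + d)%C in e by ring.
  replace (w + 0 * d)%C with w in e by ring. lra.
Qed.

Lemma cdiff_scal c f z l : cdiff f z l -> cdiff (fun w => c * f w)%C z (c * l)%C.
Proof.
intros h; replace (c * l)%C with (0 * f z + c * l)%C by ring.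
apply (cdiff_mult (fun _ => c)); [apply cdiff_const|exact h].
Qed.

Lemma lipschitz_of_cdiff f f' K z w :
  (forall z, Cmod z < 1 -> cdiff f z (f' z)) ->
  (forall z, Cmod z < 1 -> Cmod (f' z) <= K) ->
  Cmod z < 1 -> Cmod w < 1 -> Cmod (f z - f w) <= K * Cmod (z - w).
Proof.
intros hf hK hz hw.
assert (seg : forall t, 0 <= t <= 1 -> Cmod (w + RtoC t * (z - w)) < 1).
{ intros t ht; eapply Rle_lt_trans; [apply (Cmod_segment_le z w t (Rmax (Cmod z) (Cmod w))); auto|].
  - apply Rmax_l.
  - apply Rmax_r.
  - now apply Rmax_lub_lt. }
destruct (exists_unimodular (f z - f w)) as (c & c1 & c2).
destruct (mean_value_segment (fun v => c * f v)%C (fun v => c * f' v)%C w (z - w)) as (t & ht & e).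
{ intros t ht; apply cdiff_scal, hf, seg; auto. }
replace (w + (z - w))%C with z in e by ring.
rewrite <- c2. replace (Re (c * (f z - f w))) with (Re (c * f z) - Re (c * f w)) by cring.
rewrite e. eapply Rle_trans; [apply Rle_abs|]. eapply Rle_trans; [apply re_le_Cmod|].
rewrite !Cmod_mult, c1, Rmult_1_l. apply Rmult_le_compat_r; [apply Cmod_ge_0|].
apply hK, seg; auto.
Qed.

Lemma Rle_of_eps x y k : 0 <= k -> (exists e0, 0 < e0 /\ forall e, 0 < e < e0 -> x <= y + k * e) -> x <= y.
Proof.
intros hk (e0 & p & h). apply Rnot_lt_le; intros hlt.
set (D := x - y). assert (D0 : 0 < D) by (unfold D; lra).
set (e := Rmin (e0 / 2) (D / 2 / (k + 1))).
assert (pe : 0 < e) by (apply Rmin_pos; [lra|apply Rdiv_lt_0_compat; lra]).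
assert (e1 : e <= e0 / 2) by apply Rmin_l.
assert (e2 : e * (k + 1) <= D / 2).
{ apply Rle_div_r; [lra|apply Rmin_r]. }
specialize (h e ltac:(lra)). unfold D in *. nra.
Qed.

(* H' is not known to be continuous, let alone differentiable, so Schwarz--Pick is
   applied to the difference quotients of H. *)
Lemma derivative_schwarz_pick H H' L z :
  (forall z, Cmod z < 1 -> cdiff H z (H' z)) ->
  (forall z, Cmod z < 1 -> Cmod (H' z) <= L) -> 1 < L -> H' 0%C = 1%C -> Cmod z < 1 ->
  Cmod (H' z / RtoC L - / RtoC L) <= Cmod z * Cmod (1 - / RtoC L * (H' z / RtoC L)).
Proof.
intros hd hb hL h0 hz.
assert (nL : RtoC L <> 0%C) by (intros e; apply RtoC_inj in e; lra).
pose proof (Cmod_ge_0 z) as z0.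
(* Error budget: replacing quotients by derivatives costs [2 * e] on each side, and the radius [R]
   instead of 1 costs at most [2 * h <= e]. *)
apply (Rle_of_eps _ _ 6); [lra|].
exists (Rmin (L - 1) 1); split; [apply Rmin_pos; lra|]. intros e [e0 e1].
pose proof (Rmin_l (L - 1) 1). pose proof (Rmin_r (L - 1) 1).
assert (c0 : Cmod 0 < 1) by (rewrite Cmod_0; lra).
destruct (hd 0%C c0 e e0) as (d1 & p1 & h1).
destruct (hd z hz e e0) as (d2 & p2 & h2).
set (h := Rmin (Rmin d1 d2) (Rmin e (1 - Cmod z)) / 2).
assert (hh0 : 0 < h) by (unfold h; assert (0 < Rmin (Rmin d1 d2) (Rmin e (1 - Cmod z)))
  by (repeat apply Rmin_pos; lra); lra).
assert (hle : 2 * h <= d1 /\ 2 * h <= d2 /\ 2 * h <= e /\ 2 * h <= 1 - Cmod z).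
{ unfold h. pose proof (Rmin_l (Rmin d1 d2) (Rmin e (1 - Cmod z))).
  pose proof (Rmin_r (Rmin d1 d2) (Rmin e (1 - Cmod z))).
  pose proof (Rmin_l d1 d2). pose proof (Rmin_r d1 d2).
  pose proof (Rmin_l e (1 - Cmod z)). pose proof (Rmin_r e (1 - Cmod z)). lra. }
destruct hle as (hl1 & hl2 & hl3 & hl4).
set (R := 1 - h). assert (R0 : 0 < R < 1) by (unfold R; lra).
assert (nR : RtoC R <> 0%C) by (intros E; apply RtoC_inj in E; lra).
assert (nh : RtoC h <> 0%C) by (intros E; apply RtoC_inj in E; lra).
assert (mh : Cmod h = h) by (rewrite Cmod_R, Rabs_pos_eq; lra).
assert (mR : Cmod R = R) by (rewrite Cmod_R, Rabs_pos_eq; lra).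
assert (mL : Cmod L = L) by (rewrite Cmod_R, Rabs_pos_eq; lra).
(* The rescaling by [R = 1 - h] keeps both arguments in the unit disc; the Lipschitz bound for [H]
   makes the quotient at most 1 in modulus. *)
set (f := fun w => (/ (RtoC h * RtoC L) * (H (RtoC h + RtoC R * w) + -(1) * H (0 + RtoC R * w)))%C).
assert (in1 : forall w, Cmod w < 1 -> Cmod (RtoC h + RtoC R * w) < 1).
{ intros w hw; eapply Rle_lt_trans; [apply Cmod_triangle|]. rewrite Cmod_mult, mh, mR.
  unfold R in *; nra. }
assert (in2 : forall w, Cmod w < 1 -> Cmod (0 + RtoC R * w) < 1).
{ intros w hw. replace (0 + RtoC R * w)%C with (RtoC R * w)%C by ring.
  rewrite Cmod_mult, mR. pose proof (Cmod_ge_0 w); nra. }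
assert (fd : forall w, Cmod w < 1 -> exists l, cdiff f w l).
{ intros w hw; eexists; unfold f. apply cdiff_scal, cdiff_plus; [|apply cdiff_scal].
  - apply (cdiff_comp (fun w => RtoC h + RtoC R * w)%C H); [apply cdiff_affine|apply hd, in1, hw].
  - apply (cdiff_comp (fun w => 0 + RtoC R * w)%C H); [apply cdiff_affine|apply hd, in2, hw]. }
assert (fb : forall w, Cmod w < 1 -> Cmod (f w) <= 1).
{ intros w hw. unfold f. rewrite Cmod_mult, Cmod_inv, Cmod_mult, mh, mL by now apply Cmult_neq_0.
  pose proof (lipschitz_of_cdiff H H' L _ _ hd hb (in1 w hw) (in2 w hw)) as hl.
  replace (RtoC h + RtoC R * w - (0 + RtoC R * w))%C with (RtoC h) in hl by ring.
  rewrite mh in hl.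
  replace (H (RtoC h + RtoC R * w) + -(1) * H (0 + RtoC R * w))%C with
    (H (RtoC h + RtoC R * w) - H (0 + RtoC R * w))%C by ring.
  assert (0 < h * L) by nra.
  rewrite Rmult_comm. apply Rle_div_l; lra. }
assert (approx : forall y, (forall w, Cmod (w - y) < 2 * h -> Cmod (H w - H y - H' y * (w - y)) <= e * Cmod (w - y)) ->
   Cmod (f (y / RtoC R)%C - H' y / RtoC L) <= e / L).
{ intros y hy. unfold f. replace (RtoC R * (y / RtoC R))%C with y by (field; auto).
  specialize (hy (RtoC h + y)%C). replace (RtoC h + y - y)%C with (RtoC h) in hy by ring.
  rewrite mh in hy. specialize (hy ltac:(lra)).
  replace (0 + y)%C with y by ring.
  replace (/ (RtoC h * RtoC L) * (H (RtoC h + y) + - (1) * H y) - H' y / RtoC L)%C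
    with (/ (RtoC h * RtoC L) * (H (RtoC h + y) - H y - H' y * RtoC h))%C by (field; auto).
  rewrite Cmod_mult, Cmod_inv, Cmod_mult, mh, mL by now apply Cmult_neq_0.
  assert (0 < h * L) by nra.
  replace (e / L) with (/ (h * L) * (e * h)) by (field; lra).
  apply Rmult_le_compat_l; auto. left; apply Rinv_0_lt_compat; auto. }
assert (eL : e / L <= e) by (apply Rle_div_l; nra).
set (a := (/ RtoC L)%C). set (b := (H' z / RtoC L)%C).
set (A := f 0%C). set (B := f (z / RtoC R)%C).
assert (A0 : Cmod (A - a) <= e / L).
{ unfold A, a. replace (f 0%C) with (f (0 / RtoC R)%C) by (f_equal; field; auto).
  replace (/ RtoC L)%C with (H' 0%C / RtoC L)%C by (rewrite h0; field; auto).
  apply approx. intros w hw; apply h1; lra. }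
assert (B0 : Cmod (B - b) <= e / L).
{ apply approx; intros w hw; apply h2; lra. }
assert (zR : Cmod (z / RtoC R) = Cmod z / R) by (rewrite Cmod_div, mR; auto).
assert (zR1 : Cmod (z / RtoC R) < 1) by (rewrite zR; apply Rlt_div_l; unfold R in *; lra).
(* The restriction [e < L - 1] enters here: |A| is at most (1 + e) / L. *)
assert (A1 : Cmod A < 1).
{ pose proof (Cmod_triangle (A - a) a) as t. replace (A - a + a)%C with A in t by ring.
  assert (ma : Cmod a = / L) by (unfold a; rewrite Cmod_inv, mL; auto).
  assert (e / L + / L < 1); [|lra].
  replace (e / L + / L) with ((e + 1) / L) by (field; lra). apply Rlt_div_l; lra. }
assert (B1 : Cmod B <= 1) by (apply fb; auto).
assert (b1 : Cmod b <= 1).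
{ unfold b; rewrite Cmod_div, mL by auto. apply Rle_div_l; [lra|]. specialize (hb z hz); lra. }
pose proof (schwarz_pick f _ fd fb A1 zR1) as sp. fold A B in sp. rewrite zR in sp.
assert (y' : Cmod (1 - Cconj A * B) <= Cmod (1 - a * b) + 2 * e).
{ assert (ca : Cconj a = a).
  { unfold a; rewrite <- RtoC_inv by lra. cparts; f_equal; ring. }
  replace (1 - Cconj A * B)%C with ((1 - a * b) + ((Cconj a - Cconj A) * b + Cconj A * (b - B)))%C
    by (rewrite ca; ring).
  eapply Rle_trans; [apply Cmod_triangle|]. apply Rplus_le_compat_l.
  eapply Rle_trans; [apply Cmod_triangle|].
  rewrite !Cmod_mult, <- Cminus_conj, !Cmod_conj, (Cmod_minus_sym a A), (Cmod_minus_sym b B).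
  pose proof (Cmod_ge_0 b). pose proof (Cmod_ge_0 A).
  pose proof (Cmod_ge_0 (A - a)). pose proof (Cmod_ge_0 (B - b)). nra. }
assert (x' : Cmod (b - a) <= Cmod (B - A) + 2 * e).
{ replace (b - a)%C with ((B - A) + ((A - a) - (B - b)))%C by ring.
  eapply Rle_trans; [apply Cmod_triangle|]. apply Rplus_le_compat_l.
  eapply Rle_trans; [apply Cmod_minus_triangle|]. lra. }
assert (x2 : Cmod (B - A) <= 2) by (eapply Rle_trans; [apply Cmod_minus_triangle|lra]).
set (X := Cmod (B - A)) in *. set (Y := Cmod (1 - Cconj A * B)) in *.
assert (sp' : R * X <= Cmod z * Y).
{ replace (Cmod z * Y) with (R * (Cmod z / R * Y)) by (field; lra).
  apply Rmult_le_compat_l; lra. }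
assert (Cmod z * Y <= Cmod z * (Cmod (1 - a * b) + 2 * e)) by (apply Rmult_le_compat_l; auto).
unfold R in sp'. nra.
Qed.

(** * Lower bound for the real part of H' *)

(** The hypothesis puts [b] in a pseudohyperbolic disc about [a]. This is a Euclidean disc symmetric
    in the real axis, with leftmost point (a - r) / (1 - a r). *)
Lemma Re_lower_of_disc (a r : R) (b : C) : 0 < a < 1 -> 0 <= r < 1 ->
  Cmod (b - RtoC a) <= r * Cmod (1 - RtoC a * b) -> Cmod b <= 1 -> (a - r) / (1 - a * r) <= Re b.
Proof.
intros ha hr h hb.
assert (d0 : 0 < 1 - a * r) by nra.
apply Rle_div_l; auto.
assert (hx : Rabs (Re b) <= 1) by (eapply Rle_trans; [apply re_le_Cmod|auto]).
apply Rabs_le_between in hx.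
assert (h2 : Cmod (b - RtoC a) ^ 2 <= (r * Cmod (1 - RtoC a * b)) ^ 2).
{ pose proof (Cmod_ge_0 (b - RtoC a)). apply pow_incr; auto. }
rewrite Rpow_mult_distr, !Cmod2_alt in h2.
destruct b as [x y]; cparts.
assert (k : (x - a) ^ 2 <= (r * (1 - a * x)) ^ 2).
{ assert (r * a < 1) by nra. assert (0 <= r * a) by nra.
  assert (0 <= y ^ 2 * (1 - (r * a) ^ 2)).
  { apply Rmult_le_pos; [apply pow2_ge_0|]. nra. }
  nra. }
assert (p : 0 <= r * (1 - a * x)) by (apply Rmult_le_pos; nra).
assert (q : a - x <= r * (1 - a * x)).
{ apply Rnot_lt_le; intros hlt. nra. }
lra.
Qed.

Lemma Re_derivative_lower H H' L z :
  (forall z, Cmod z < 1 -> cdiff H z (H' z)) ->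
  (forall z, Cmod z < 1 -> Cmod (H' z) <= L) -> 1 < L -> H' 0%C = 1%C -> Cmod z < 1 ->
  L * (1 - L * Cmod z) / (L - Cmod z) <= Re (H' z).
Proof.
intros hd hb hL h0 hz. pose proof (Cmod_ge_0 z).
pose proof (derivative_schwarz_pick H H' L z hd hb hL h0 hz) as h.
assert (nL : RtoC L <> 0%C) by (intros e; apply RtoC_inj in e; lra).
assert (i1 : 0 < / L < 1).
{ split; [apply Rinv_0_lt_compat; lra|]. rewrite <- Rinv_1. apply Rinv_lt_contravar; lra. }
rewrite <- RtoC_inv in h by lra.
assert (g : (/ L - Cmod z) / (1 - / L * Cmod z) <= Re (H' z / RtoC L)%C).
{ apply Re_lower_of_disc; auto. rewrite Cmod_div by auto.
  rewrite Cmod_R, Rabs_pos_eq by lra. apply Rle_div_l; [lra|]. specialize (hb z hz); lra. }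
replace (Re (H' z / RtoC L)%C) with (Re (H' z) / L) in g.
- apply (Rmult_le_compat_l L) in g; [|lra].
  replace (L * (Re (H' z) / L)) with (Re (H' z)) in g by (field; lra).
  eapply Rle_trans; [|exact g]. right; field; lra.
- unfold Cdiv; rewrite <- RtoC_inv by lra. unfold Rdiv. cring.
Qed.

(** * Bi-analytic functions *)

Definition mu (L1 L2 r : R) : R := L2 * (1 - L2 * r) / (L2 - r) - 2 * L1 * r.

Definition sigma_at (L1 L2 r : R) : R :=
  L2 ^ 2 * r - L1 * r ^ 2 + (L2 ^ 3 - L2) * ln (1 - r / L2).

Lemma sigma_derive L1 L2 r : 1 < L2 -> r < 1 -> is_derive (sigma_at L1 L2) r (mu L1 L2 r).
Proof.
intros h hr. unfold sigma_at, mu. assert (r / L2 < 1) by (apply Rlt_div_l; lra).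
auto_derive; [lra|].
field; lra.
Qed.

Lemma sigma_0 L1 L2 : 1 < L2 -> sigma_at L1 L2 0 = 0.
Proof.
intros h; unfold sigma_at. replace (1 - 0 / L2) with 1 by (field; lra). rewrite ln_1; ring.
Qed.

Lemma mu_decreasing L1 L2 x y : 0 <= L1 -> 1 < L2 -> x < y < 1 -> mu L1 L2 y < mu L1 L2 x.
Proof.
intros h1 h2 h. unfold mu.
(* The partial fraction leaves r only in 1 / (L2 - r), with a negative coefficient; strictness thus
   holds even for [L1 = 0]. *)
assert (e : forall r, r < 1 -> L2 * (1 - L2 * r) / (L2 - r) = L2 ^ 2 - L2 * (L2 ^ 2 - 1) * / (L2 - r)).
{ intros r hr; field; lra. }
rewrite !e by lra.
assert (/ (L2 - x) < / (L2 - y)) by (apply Rinv_lt_contravar; [apply Rmult_lt_0_compat|]; lra).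
assert (0 < L2 * (L2 ^ 2 - 1)) by (apply Rmult_lt_0_compat; nra).
nra.
Qed.

Lemma mu_decreasing_le L1 L2 x y : 0 <= L1 -> 1 < L2 -> x <= y < 1 -> mu L1 L2 y <= mu L1 L2 x.
Proof.
intros h1 h2 [[h| ->] h']; [left; apply mu_decreasing|]; lra.
Qed.

Lemma rho1_spec L1 L2 : 0 <= L1 -> 1 < L2 ->
  0 < rho1 L1 L2 < 1 /\ mu L1 L2 (rho1 L1 L2) = 0.
Proof.
intros h1 h2. unfold rho1.
set (B := L2 * (2 * L1 + L2)).
replace (L2 ^ 2 * (2 * L1 + L2) ^ 2) with (B ^ 2) by (unfold B; ring).
assert (B0 : L2 * L2 <= B) by (unfold B; apply Rmult_le_compat_l; lra).
(* [L2 > 1] bounds B^2 below by (2 L1 + L2)^2, and subtracting 8 L1 L2 from that leaves the square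
   (2 L1 - L2)^2. *)
assert (D0 : 0 <= B ^ 2 - 8 * L1 * L2).
{ assert (0 <= (2 * L1 - L2) ^ 2) by apply pow2_ge_0.
  assert (1 * (2 * L1 + L2) ^ 2 <= L2 ^ 2 * (2 * L1 + L2) ^ 2).
  { apply Rmult_le_compat_r; [apply pow2_ge_0|nra]. }
  unfold B; nra. }
set (S := sqrt (B ^ 2 - 8 * L1 * L2)).
assert (S0 : 0 <= S) by apply sqrt_pos.
assert (S2 : S * S = B ^ 2 - 8 * L1 * L2) by (apply sqrt_sqrt; auto).
assert (BS : 2 * L2 < B + S).
(* Squaring S <= 2 L2 - B would give B <= L2 + 2 L1, against [L2 > 1]. *)
{ apply Rnot_le_lt; intros hle.
  assert (hB : L2 + 2 * L1 < B) by (unfold B; nra).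
  assert (S * S <= (2 * L2 - B) * (2 * L2 - B)) by (apply Rmult_le_compat; lra).
  nra. }
assert (r1 : 2 * L2 / (B + S) < 1) by (apply Rlt_div_l; lra).
split; [split; [apply Rdiv_lt_0_compat; lra|auto]|].
set (r := 2 * L2 / (B + S)) in *.
assert (q : 2 * L1 * r ^ 2 - B * r + L2 = 0).
{ unfold r. replace (2 * L1 * (2 * L2 / (B + S)) ^ 2 - B * (2 * L2 / (B + S)) + L2)
    with (L2 * (8 * L1 * L2 - B ^ 2 + S * S) / (B + S) ^ 2) by (field; lra).
  rewrite S2. field; lra. }
unfold mu. replace (L2 * (1 - L2 * r) / (L2 - r) - 2 * L1 * r)
  with ((2 * L1 * r ^ 2 - L2 * (2 * L1 + L2) * r + L2) / (L2 - r)) by (field; lra).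
fold B; rewrite q; field; lra.
Qed.

Section Bianalytic.
Context (L1 L2 : R) (hL1 : 0 <= L1) (hL2 : 1 < L2) (G H G' H' : C -> C)
  (hyps : hyp L1 L2 G H G' H').

Let F (z : C) : C := (Cconj z * G z + H z)%C.

Lemma G_cdiff z : Cmod z < 1 -> cdiff G z (G' z).
Proof. intros hz; apply has_cderiv_cdiff; now apply hyps. Qed.

Lemma H_cdiff z : Cmod z < 1 -> cdiff H z (H' z).
Proof. intros hz; apply has_cderiv_cdiff; now apply hyps. Qed.

Lemma G'_le z : Cmod z < 1 -> Cmod (G' z) <= L1.
Proof. intros hz; now apply hyps. Qed.

Lemma H'_le z : Cmod z < 1 -> Cmod (H' z) <= L2.
Proof. intros hz; left; now apply hyps. Qed.

Lemma G_le z : Cmod z < 1 -> Cmod (G z) <= L1 * Cmod z.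
Proof.
intros hz. assert (c0 : Cmod 0 < 1) by (rewrite Cmod_0; lra).
pose proof (lipschitz_of_cdiff G G' L1 z 0 G_cdiff G'_le hz c0) as h.
replace (G 0%C) with (RtoC 0) in h by (symmetry; apply hyps).
replace (G z - 0)%C with (G z) in h by ring. replace (z - 0)%C with z in h by ring. exact h.
Qed.

(* On the line w + t d the conjugate of v is the affine function
   conj w + (conj d / d) (v - w), so F coincides there with a holomorphic function
   whose derivative is F_z + (conj d / d) F_zbar. *)
Definition F_line (w d v : C) : C := ((Cconj w + Cconj d / d * (v - w)) * G v + H v)%C.
Definition F_line' (w d v : C) : C :=
  (Cconj d / d * G v + (Cconj w + Cconj d / d * (v - w)) * G' v + H' v)%C.

Lemma F_line_eq (w d : C) (t : R) : d <> 0%C -> F_line w d (w + RtoC t * d) = F (w + RtoC t * d)%C.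
Proof.
intros hd. unfold F_line, F. f_equal; f_equal.
rewrite Cplus_conj, Cmult_conj. replace (Cconj (RtoC t)) with (RtoC t) by (cparts; f_equal; ring).
field; auto.
Qed.

Lemma F_line_cdiff (w d v : C) : Cmod v < 1 -> cdiff (F_line w d) v (F_line' w d v).
Proof.
intros hv. unfold F_line, F_line'. apply cdiff_plus; [|now apply H_cdiff].
apply (cdiff_mult (fun v => Cconj w + Cconj d / d * (v - w))%C); [|now apply G_cdiff].
apply (cdiff_ext (fun v => (Cconj w - Cconj d / d * w) + Cconj d / d * v)%C _ _ _ 1);
  [lra|intros; ring|apply cdiff_affine].
Qed.

(** On the line the affine factor is [Cconj v], and [Cconj d / d] is unimodular. Each of the two
    terms from G therefore costs at most L1 |v|, whence the 2 L1 r in [mu]. *)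
Lemma F_line'_lower (w d : C) (t : R) : d <> 0%C -> Cmod (w + RtoC t * d) < 1 ->
  mu L1 L2 (Cmod (w + RtoC t * d)) <= Re (F_line' w d (w + RtoC t * d)).
Proof.
intros hd hv. set (v := (w + RtoC t * d)%C) in *.
assert (hb : L2 * (1 - L2 * Cmod v) / (L2 - Cmod v) <= Re (H' v)).
{ apply (Re_derivative_lower H); auto; [apply H_cdiff|apply H'_le|apply hyps]. }
assert (e : (Cconj w + Cconj d / d * (v - w))%C = Cconj v).
{ unfold v; rewrite Cplus_conj, Cmult_conj.
  replace (Cconj (RtoC t)) with (RtoC t) by (cparts; f_equal; ring). field; auto. }
unfold F_line'. rewrite e.
assert (g1 : Cmod (Cconj d / d * G v) <= L1 * Cmod v).
{ rewrite Cmod_mult, Cmod_div, Cmod_conj by auto. apply Cmod_gt_0 in hd.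
  replace (Cmod d / Cmod d) with 1 by (field; lra). rewrite Rmult_1_l. now apply G_le. }
assert (g2 : Cmod (Cconj v * G' v) <= L1 * Cmod v).
{ rewrite Cmod_mult, Cmod_conj, Rmult_comm. apply Rmult_le_compat_r; [apply Cmod_ge_0|now apply G'_le]. }
pose proof (re_le_Cmod (Cconj d / d * G v)) as r1. pose proof (re_le_Cmod (Cconj v * G' v)) as r2.
assert (r1' := Rle_trans _ _ _ r1 g1). assert (r2' := Rle_trans _ _ _ r2 g2).
apply Rabs_le_between in r1'. apply Rabs_le_between in r2'.
replace (Re (Cconj d / d * G v + Cconj v * G' v + H' v)%C) with
  (Re (Cconj d / d * G v)%C + Re (Cconj v * G' v)%C + Re (H' v)) by reflexivity.
unfold mu; lra.
Qed.

Lemma Re_conj_self (d k : C) : Re (Cconj d * k * d) = Cmod d ^ 2 * Re k.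
Proof. rewrite Cmod2_alt; cring. Qed.

(** Multiplication by [Cconj d] turns the increment along the segment into |d|^2 times the real part
    of [F_line']. The segment stays in the disc of radius [s], where [mu] is smallest on the
    boundary. *)
Lemma F_strongly_monotone z w s : Cmod z <= s -> Cmod w <= s -> s < 1 ->
  mu L1 L2 s * Cmod (z - w) ^ 2 <= Re (Cconj (z - w) * (F z - F w)).
Proof.
intros hz hw hs. set (d := (z - w)%C).
destruct (Ceq_dec d 0) as [e|hd].
{ replace (F z) with (F w); [rewrite e, Cmod_0; right; cring|].
  f_equal. replace z with (d + w)%C by (unfold d; ring). rewrite e; ring. }
assert (seg : forall t, 0 <= t <= 1 -> Cmod (w + RtoC t * d) <= s).
{ intros t ht; apply Cmod_segment_le; auto. }
destruct (mean_value_segment (fun v => Cconj d * F_line w d v)%C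
  (fun v => Cconj d * F_line' w d v)%C w d) as (t & ht & e).
{ intros t ht; apply cdiff_scal, F_line_cdiff. specialize (seg t ht); lra. }
replace (F_line w d (w + d)%C) with (F z) in e.
2:{ replace (w + d)%C with (w + RtoC 1 * d)%C by ring. rewrite F_line_eq by auto.
    f_equal; unfold d; ring. }
replace (F_line w d w) with (F w) in e.
2:{ replace w with (w + RtoC 0 * d)%C at 3 by ring. rewrite F_line_eq by auto. f_equal; ring. }
rewrite Re_conj_self in e.
replace (Re (Cconj d * (F z - F w))) with (Re (Cconj d * F z) - Re (Cconj d * F w)) by cring.
rewrite e, Rmult_comm. apply Rmult_le_compat_l; [apply pow2_ge_0|].
specialize (seg t ht).
eapply Rle_trans; [|apply F_line'_lower; auto; lra]. apply mu_decreasing_le; lra.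
Qed.

(** Along the radius both sides start from 0, and [phi], their difference, has derivative |z|^2 (Re
    F_line' - mu), which is nonnegative. *)
Lemma F_radial z : Cmod z < 1 -> Cmod z * sigma_at L1 L2 (Cmod z) <= Re (Cconj z * F z).
Proof.
intros hz. destruct (Ceq_dec z 0) as [->|nz].
{ rewrite Cmod_0. right; cring. }
assert (m0 : 0 < Cmod z) by now apply Cmod_gt_0.
assert (mt : forall t, 0 <= t <= 1 -> Cmod (0 + RtoC t * z) = t * Cmod z).
{ intros t ht. replace (0 + RtoC t * z)%C with (RtoC t * z)%C by ring.
  rewrite Cmod_mult, Cmod_R, Rabs_pos_eq; lra. }
set (phi := fun t => Re (Cconj z * F_line 0 z (0 + RtoC t * z)) - Cmod z * sigma_at L1 L2 (t * Cmod z)).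
assert (dphi : forall t, 0 <= t <= 1 -> is_derive phi t
   (Re (Cconj z * F_line' 0 z (0 + RtoC t * z) * z) - Cmod z * (Cmod z * mu L1 L2 (t * Cmod z)))).
{ intros t ht. unfold phi. apply (is_derive_minus (V := R_NormedModule)).
  - apply (cdiff_line (fun v => Cconj z * F_line 0 z v)%C). apply cdiff_scal, F_line_cdiff.
    rewrite mt by auto. nra.
  - apply (is_derive_scal (fun t => sigma_at L1 L2 (t * Cmod z)) t (Cmod z)).
    apply (is_derive_comp (sigma_at L1 L2) (fun t => t * Cmod z)).
    + apply sigma_derive; auto. nra.
    + auto_derive; auto; ring. }
destruct (MVT_gen phi 0 1 (fun t => Re (Cconj z * F_line' 0 z (0 + RtoC t * z) * z)
   - Cmod z * (Cmod z * mu L1 L2 (t * Cmod z)))) as (t & ht & e).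
- rewrite Rmin_left, Rmax_right by lra. intros t ht; apply dphi; lra.
- rewrite Rmin_left, Rmax_right by lra. intros t ht.
  apply continuity_pt_filterlim, (ex_derive_continuous (K := R_AbsRing) (V := R_NormedModule)).
  eexists; apply dphi; lra.
- rewrite Rmin_left, Rmax_right in ht by lra.
  rewrite Re_conj_self in e.
  assert (hv : Cmod (0 + RtoC t * z) < 1) by (rewrite mt by auto; nra).
  pose proof (F_line'_lower 0 z t nz hv) as low. rewrite mt in low by auto.
  assert (phi 1 - phi 0 >= 0).
  { rewrite e. set (A := Re _) in *. set (B := mu _ _ _) in *.
    pose proof (pow2_ge_0 (Cmod z)). nra. }
  assert (p0 : phi 0 = 0).
  { unfold phi. rewrite Rmult_0_l, sigma_0 by auto. rewrite F_line_eq by auto.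
    replace (0 + 0 * z)%C with (RtoC 0) by ring. unfold F.
    replace (G 0%C) with (RtoC 0) by (symmetry; apply hyps).
    replace (H 0%C) with (RtoC 0) by (symmetry; apply hyps). cring. }
  assert (p1 : phi 1 = Re (Cconj z * F z) - Cmod z * sigma_at L1 L2 (Cmod z)).
  { unfold phi. rewrite F_line_eq by auto. replace (0 + 1 * z)%C with z by ring.
    now rewrite Rmult_1_l. }
  lra.
Qed.

Lemma F_lipschitz z w : Cmod z < 1 -> Cmod w < 1 ->
  Cmod (F z - F w) <= (2 * L1 + L2) * Cmod (z - w).
Proof.
intros hz hw.
pose proof (lipschitz_of_cdiff G G' L1 z w G_cdiff G'_le hz hw) as hG.
pose proof (lipschitz_of_cdiff H H' L2 z w H_cdiff H'_le hz hw) as hH.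
unfold F. replace (Cconj z * G z + H z - (Cconj w * G w + H w))%C with
  ((Cconj (z - w) * G z + Cconj w * (G z - G w)) + (H z - H w))%C
  by (rewrite Cminus_conj; ring).
eapply Rle_trans; [apply Cmod_triangle|].
pose proof (Cmod_triangle (Cconj (z - w) * G z) (Cconj w * (G z - G w))) as t.
rewrite !Cmod_mult, !Cmod_conj in t.
pose proof (G_le z hz). pose proof (Cmod_ge_0 (z - w)). pose proof (Cmod_ge_0 z).
pose proof (Cmod_ge_0 w). pose proof (Cmod_ge_0 (G z - G w)).
assert (Cmod (G z) <= L1) by nra.
assert (Cmod (z - w) * Cmod (G z) <= Cmod (z - w) * L1) by (apply Rmult_le_compat_l; auto).
assert (Cmod w * Cmod (G z - G w) <= 1 * Cmod (G z - G w)) by (apply Rmult_le_compat_r; lra).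
lra.
Qed.

Lemma F_univalent : univalent_on F (cdisc (rho1 L1 L2)).
Proof.
intros z w hz hw e. unfold cdisc in *. destruct (rho1_spec L1 L2 hL1 hL2) as [r1 r2].
set (s := Rmax (Cmod z) (Cmod w)).
assert (hs : s < rho1 L1 L2) by now apply Rmax_lub_lt.
pose proof (F_strongly_monotone z w s (Rmax_l _ _) (Rmax_r _ _) ltac:(lra)) as h.
replace (F z - F w)%C with (RtoC 0) in h by (rewrite e; ring).
replace (Re (Cconj (z - w) * 0)) with 0 in h by cring.
pose proof (mu_decreasing L1 L2 s (rho1 L1 L2) hL1 hL2 ltac:(lra)) as hm. rewrite r2 in hm.
destruct (Ceq_dec (z - w)%C 0) as [e0|n].
- replace z with ((z - w) + w)%C by ring. rewrite e0; ring.
- apply Cmod_gt_0 in n. assert (0 < Cmod (z - w) ^ 2) by nra. nra.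
Qed.

End Bianalytic.

(** * The covered disc *)

Lemma geometric_increments_converge (u : nat -> R) k c : 0 <= k < 1 ->
  (forall n, Rabs (u (S n) - u n) <= c * k ^ n) -> exists l : R, is_lim_seq u l.
Proof.
intros hk hu.
assert (hs : ex_series (fun n => u (S n) - u n)).
{ apply (ex_series_le (K := R_AbsRing) (V := R_CompleteNormedModule) _ (fun n => c * k ^ n)); [exact hu|].
  apply (ex_series_scal (V := R_NormedModule) c), ex_series_geom. rewrite Rabs_pos_eq; lra. }
destruct hs as [l hl]. exists (u 0%nat + l).
apply is_lim_seq_incr_1.
apply is_lim_seq_ext with (fun n => u 0%nat + sum_n (fun n => u (S n) - u n) n).
- intros n; induction n as [|n IH].
  + rewrite sum_O; ring.
  + rewrite sum_Sn. unfold plus; simpl. lra.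
- apply (is_lim_seq_plus' (fun _ => u 0%nat)); [apply is_lim_seq_const|exact hl].
Qed.

(** Banach's iteration from 0, with the limit taken in each coordinate; both estimates on [T] are
    confined to the disc, so the iterates must be kept inside it. *)
Lemma disc_contraction_fixpoint (T : C -> C) s k : 0 <= s -> 0 <= k < 1 ->
  (forall z, Cmod z <= s -> Cmod (T z) <= s) ->
  (forall z w, Cmod z <= s -> Cmod w <= s -> Cmod (T z - T w) <= k * Cmod (z - w)) ->
  exists z, Cmod z <= s /\ T z = z.
Proof.
intros hs hk hT hc.
set (x := fun n => Nat.iter n T 0%C).
assert (xs : forall n, Cmod (x n) <= s).
{ intros n; induction n as [|n IH]; [simpl; rewrite Cmod_0; auto|apply hT, IH]. }
assert (inc : forall n, Cmod (x (S n) - x n) <= Cmod (x 1%nat - x 0%nat) * k ^ n).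
{ intros n; induction n as [|n IH]; [simpl; lra|].
  change (x (S (S n))) with (T (x (S n))). change (x (S n)) with (T (x n)) at 2.
  eapply Rle_trans; [apply hc; auto|]. simpl pow. nra. }
destruct (geometric_increments_converge (fun n => Re (x n)) k (Cmod (x 1%nat - x 0%nat))) as [a ha]; auto.
{ intros n. eapply Rle_trans; [|apply inc]. apply (re_le_Cmod (x (S n) - x n)%C). }
destruct (geometric_increments_converge (fun n => Im (x n)) k (Cmod (x 1%nat - x 0%nat))) as [b hb]; auto.
{ intros n. eapply Rle_trans; [|apply inc]. apply (Rabs_Im_le (x (S n) - x n)%C). }
assert (lim : forall e, 0 < e -> exists N, forall n, (N <= n)%nat -> Cmod (x n - (a, b)) < e).
{ intros e he. assert (he2 : 0 < e / 2) by lra.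
  apply is_lim_seq_spec in ha. apply is_lim_seq_spec in hb.
  destruct (ha (mkposreal _ he2)) as [N1 h1]. destruct (hb (mkposreal _ he2)) as [N2 h2].
  exists (N1 + N2)%nat; intros n hn.
  specialize (h1 n ltac:(lia)). specialize (h2 n ltac:(lia)). cbn in h1, h2.
  replace e with (2 * (e / 2)) by field. apply Cmod_lt_of_components; [exact h1|exact h2]. }
set (z := (a, b) : C) in *.
assert (zs : Cmod z <= s).
{ apply (Rle_of_eps _ _ 1); [lra|]. exists 1; split; [lra|]; intros e he.
  destruct (lim e ltac:(lra)) as [N h]. specialize (h N (le_n N)).
  pose proof (Cmod_minus_triangle_rev z (x N)). rewrite Cmod_minus_sym in H.
  specialize (xs N). lra. }
exists z; split; auto.
assert (h0 : Cmod (T z - z) <= 0).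
{ apply (Rle_of_eps _ _ 2); [lra|]. exists 1; split; [lra|]; intros e he.
  destruct (lim e ltac:(lra)) as [N h].
  pose proof (h N (le_n N)) as hN. pose proof (h (S N) ltac:(lia)) as hSN.
  change (x (S N)) with (T (x N)) in hSN.
  replace (T z - z)%C with ((T z - T (x N)) + (T (x N) - z))%C by ring.
  eapply Rle_trans; [apply Cmod_triangle|].
  pose proof (hc z (x N) zs (xs N)) as q. rewrite (Cmod_minus_sym z) in q.
  pose proof (Cmod_ge_0 (x N - z)). nra. }
pose proof (Cmod_ge_0 (T z - z)).
assert (e : (T z - z)%C = 0%C) by (apply Cmod_eq_0; lra).
replace (T z) with ((T z - z) + z)%C by ring. rewrite e; ring.
Qed.

Lemma Cmod_sub_sq (u v : C) (e : R) :
  Cmod (u - RtoC e * v) ^ 2 = Cmod u ^ 2 - 2 * e * Re (Cconj u * v) + e ^ 2 * Cmod v ^ 2.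
Proof. rewrite !Cmod2_alt; cring. Qed.

Lemma le_of_pow2_le x y : 0 <= y -> x ^ 2 <= y ^ 2 -> x <= y.
Proof. intros hy h; apply Rnot_lt_le; intros hlt; nra. Qed.

(* For small eps the map z - eps (F z - w) contracts the disc of radius s; it maps it
   to itself because F z - w points outwards on the ring s' <= |z| <= s. *)
Lemma strongly_monotone_solve (F : C -> C) (w : C) s' s m L del :
  0 < s' < s -> 0 < m -> 0 < L -> 0 < del ->
  (forall z v, Cmod z <= s -> Cmod v <= s ->
     m * Cmod (z - v) ^ 2 <= Re (Cconj (z - v) * (F z - F v))) ->
  (forall z v, Cmod z <= s -> Cmod v <= s -> Cmod (F z - F v) <= L * Cmod (z - v)) ->
  (forall z, s' <= Cmod z <= s -> del <= Re (Cconj z * (F z - w))) ->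
  exists z, Cmod z <= s /\ F z = w.
Proof.
intros hs hm hL hdel hmon hlip hout.
set (M := Cmod (F 0 - w) + L * s + 1).
assert (M0 : 0 < M).
{ unfold M; pose proof (Cmod_ge_0 (F 0%C - w)). assert (0 < L * s) by (apply Rmult_lt_0_compat; lra). lra. }
assert (hM : forall z, Cmod z <= s -> Cmod (F z - w) <= M).
{ intros z hz. replace (F z - w)%C with ((F z - F 0) + (F 0 - w))%C by ring.
  eapply Rle_trans; [apply Cmod_triangle|].
  assert (c0 : Cmod 0 <= s) by (rewrite Cmod_0; lra).
  pose proof (hlip z 0%C hz c0) as h. replace (z - 0)%C with z in h by ring.
  assert (L * Cmod z <= L * s) by (apply Rmult_le_compat_l; lra). unfold M; lra. }
(* In order: a point of the inner disc moves by at most [s - s']; on the ring the quadratic term e^2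
   M^2 is absorbed by the gain 2 e del; the squared contraction factor 1 - 2 e m + e^2 L^2 is at
   most 1 - e m; and 1 - e m stays positive. *)
set (e := Rmin (Rmin ((s - s') / M) (2 * del / M ^ 2)) (Rmin (m / L ^ 2) (/ (2 * m)))).
assert (L2 : 0 < L ^ 2) by nra. assert (M2 : 0 < M ^ 2) by nra.
assert (e0 : 0 < e).
{ repeat apply Rmin_pos; try apply Rdiv_lt_0_compat; try apply Rinv_0_lt_compat; lra. }
assert (e1 : e <= (s - s') / M) by (eapply Rle_trans; [apply Rmin_l|apply Rmin_l]).
assert (e2 : e <= 2 * del / M ^ 2) by (eapply Rle_trans; [apply Rmin_l|apply Rmin_r]).
assert (e3 : e <= m / L ^ 2) by (eapply Rle_trans; [apply Rmin_r|apply Rmin_l]).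
assert (e4 : e <= / (2 * m)) by (eapply Rle_trans; [apply Rmin_r|apply Rmin_r]).
apply Rle_div_r in e1; auto. apply Rle_div_r in e2; auto. apply Rle_div_r in e3; auto.
assert (e4' : e * m <= / 2).
{ apply (Rmult_le_compat_r m) in e4; [|lra]. replace (/ (2 * m) * m) with (/ 2) in e4 by (field; lra). exact e4. }
assert (em : 0 < e * m) by (apply Rmult_lt_0_compat; auto).
set (k := sqrt (1 - e * m)).
assert (k2 : k ^ 2 = 1 - e * m) by (unfold k; rewrite pow2_sqrt; lra).
assert (k0 : 0 <= k) by apply sqrt_pos.
assert (k1 : k < 1) by nra.
destruct (disc_contraction_fixpoint (fun z => z - RtoC e * (F z - w))%C s k) as (z & hz & fz); [lra|lra| | |].
- intros z hz. destruct (Rle_dec (Cmod z) s') as [h|h].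
  + eapply Rle_trans; [apply Cmod_minus_triangle|]. rewrite Cmod_mult, Cmod_R, Rabs_pos_eq by lra.
    specialize (hM z hz). assert (e * Cmod (F z - w) <= e * M) by (apply Rmult_le_compat_l; lra). lra.
  + apply le_of_pow2_le; [lra|]. rewrite Cmod_sub_sq.
    specialize (hM z hz). pose proof (hout z ltac:(lra)) as ho.
    assert (Cmod (F z - w) ^ 2 <= M ^ 2) by (apply pow_incr; split; [apply Cmod_ge_0|auto]).
    assert (Cmod z ^ 2 <= s ^ 2) by (apply pow_incr; split; [apply Cmod_ge_0|auto]).
    assert (e * del <= e * Re (Cconj z * (F z - w))) by (apply Rmult_le_compat_l; lra).
    assert (e ^ 2 * Cmod (F z - w) ^ 2 <= e * (e * M ^ 2)).
    { replace (e * (e * M ^ 2)) with (e ^ 2 * M ^ 2) by ring. apply Rmult_le_compat_l; nra. }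
    assert (e * (e * M ^ 2) <= e * (2 * del)) by (apply Rmult_le_compat_l; lra).
    lra.
- intros z v hz hv. apply le_of_pow2_le; [apply Rmult_le_pos; [auto|apply Cmod_ge_0]|].
  replace (z - RtoC e * (F z - w) - (v - RtoC e * (F v - w)))%C
    with ((z - v) - RtoC e * (F z - F v))%C by ring.
  rewrite Cmod_sub_sq, Rpow_mult_distr, k2.
  specialize (hmon z v hz hv). specialize (hlip z v hz hv).
  assert (hl2 : Cmod (F z - F v) ^ 2 <= L ^ 2 * Cmod (z - v) ^ 2).
  { rewrite <- Rpow_mult_distr; apply pow_incr; split; [apply Cmod_ge_0|auto]. }
  set (X := Cmod (z - v) ^ 2) in *. assert (X0 : 0 <= X) by apply pow2_ge_0.
  assert (e * (m * X) <= e * Re (Cconj (z - v) * (F z - F v))) by (apply Rmult_le_compat_l; lra).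
  assert (e ^ 2 * Cmod (F z - F v) ^ 2 <= e ^ 2 * (L ^ 2 * X)) by (apply Rmult_le_compat_l; nra).
  assert (e ^ 2 * (L ^ 2 * X) <= e * m * X).
  { replace (e ^ 2 * (L ^ 2 * X)) with (e * (e * L ^ 2) * X) by ring.
    apply Rmult_le_compat_r; auto. apply Rmult_le_compat_l; lra. }
  lra.
- exists z; split; auto.
  assert (h : Cmod (RtoC e * (F z - w)) = 0).
  { replace (RtoC e * (F z - w))%C with (z - (z - RtoC e * (F z - w)))%C by ring.
    rewrite fz; apply Cmod_self. }
  rewrite Cmod_mult, Cmod_R, Rabs_pos_eq in h by lra.
  assert (h' : (F z - w)%C = 0%C) by (apply Cmod_eq_0; nra).
  replace (F z) with ((F z - w) + w)%C by ring. rewrite h'; ring.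
Qed.

Lemma sigma_increasing L1 L2 x y : 0 <= L1 -> 1 < L2 -> 0 <= x < y -> y <= rho1 L1 L2 ->
  sigma_at L1 L2 x < sigma_at L1 L2 y.
Proof.
intros h1 h2 hxy hy. destruct (rho1_spec L1 L2 h1 h2) as [r1 r2].
destruct (MVT_cor2 (sigma_at L1 L2) (mu L1 L2) x y) as (c & e & hc); [lra| |].
- intros c hc; apply is_derive_Reals, sigma_derive; lra.
- pose proof (mu_decreasing L1 L2 c (rho1 L1 L2) h1 h2 ltac:(lra)). nra.
Qed.

Lemma sigma_continuous L1 L2 r : 1 < L2 -> r < 1 -> continuity_pt (sigma_at L1 L2) r.
Proof.
intros h hr. apply continuity_pt_filterlim, (ex_derive_continuous (K := R_AbsRing) (V := R_NormedModule)).
eexists; now apply sigma_derive.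
Qed.

Lemma bianalytic_covering L1 L2 (G H G' H' : C -> C) (w : C) :
  0 <= L1 -> 1 < L2 -> hyp L1 L2 G H G' H' -> Cmod w < sigma_at L1 L2 (rho1 L1 L2) ->
  exists z, Cmod z < rho1 L1 L2 /\ (Cconj z * G z + H z)%C = w.
Proof.
intros h1 h2 hyps hw. destruct (rho1_spec L1 L2 h1 h2) as [r1 r2].
set (rho := rho1 L1 L2) in *.
assert (gap : 0 < (sigma_at L1 L2 rho - Cmod w)) by lra.
destruct (proj1 (continuity_pt_locally _ _) (sigma_continuous L1 L2 rho h2 (proj2 r1))
  (mkposreal _ gap)) as [d hd].
pose proof (cond_pos d).
set (t := Rmin (d / 2) (rho / 2)).
assert (t0 : 0 < t) by (apply Rmin_pos; lra).
assert (t1 : t <= d / 2) by apply Rmin_l. assert (t2 : t <= rho / 2) by apply Rmin_r.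
(* Both radii stay below [rho1], so that [mu] is positive at [s]; continuity of [sigma_at] keeps its
   value at [s'] above |w|. *)
set (s' := rho - t). set (s := rho - t / 2).
assert (hs' : Cmod w < sigma_at L1 L2 s').
{ specialize (hd s'). change (Rabs (s' - rho) < d -> Rabs (sigma_at L1 L2 s' - sigma_at L1 L2 rho)
    < sigma_at L1 L2 rho - Cmod w) in hd.
  assert (q := hd ltac:(unfold s'; apply Rabs_def1; lra)). apply Rabs_def2 in q. lra. }
assert (ss : 0 < s' < s /\ s < rho) by (unfold s, s'; lra).
destruct (strongly_monotone_solve (fun z => Cconj z * G z + H z)%C w s' s (mu L1 L2 s)
  (2 * L1 + L2) (s' * (sigma_at L1 L2 s' - Cmod w))) as (z & hz & e); try lra.
- pose proof (mu_decreasing L1 L2 s rho h1 h2 ltac:(lra)). lra.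
- apply Rmult_lt_0_compat; lra.
- intros z v hz hv. apply (F_strongly_monotone L1 L2 h1 h2 G H G' H' hyps); lra.
- intros z v hz hv. apply (F_lipschitz L1 L2 h1 G H G' H' hyps); lra.
- intros z hz.
  pose proof (F_radial L1 L2 h2 G H G' H' hyps z ltac:(lra)) as hr.
  cbv zeta in hr.
  assert (sm : sigma_at L1 L2 s' <= sigma_at L1 L2 (Cmod z)).
  { destruct (Req_dec s' (Cmod z)) as [<-|n]; [lra|]. left; apply sigma_increasing; fold rho; lra. }
  replace (Re (Cconj z * (Cconj z * G z + H z - w))%C)
    with (Re (Cconj z * (Cconj z * G z + H z))%C - Re (Cconj z * w)%C) by cring.
  pose proof (re_le_Cmod (Cconj z * w)) as hzw. rewrite Cmod_mult, Cmod_conj in hzw.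
  apply Rabs_le_between in hzw.
  assert (Cmod z * sigma_at L1 L2 s' <= Cmod z * sigma_at L1 L2 (Cmod z)) by (apply Rmult_le_compat_l; lra).
  assert (s' * (sigma_at L1 L2 s' - Cmod w) <= Cmod z * (sigma_at L1 L2 s' - Cmod w))
    by (apply Rmult_le_compat_r; lra).
  lra.
- exists z; split; [lra|exact e].
Qed.

(** * The extremal function *)

(** The converse of [cdiff_Re] and [cdiff_Im], stated with total differentiability because partial
    derivatives alone would not suffice. *)
Lemma cdiff_of_cauchy_riemann (f : C -> C) x y p q :
  differentiable_pt_lim (fun u v => Re (f (u, v))) x y p (- q) ->
  differentiable_pt_lim (fun u v => Im (f (u, v))) x y q p ->
  cdiff f (x, y) (p, q).
Proof.
intros hr hi e he. assert (he2 : 0 < e / 2) by lra.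
destruct (hr (mkposreal _ he2)) as [d1 h1]. destruct (hi (mkposreal _ he2)) as [d2 h2].
exists (Rmin d1 d2); split; [apply Rmin_pos; apply cond_pos|].
intros [u v] hw. pose proof (Rmin_l d1 d2). pose proof (Rmin_r d1 d2).
pose proof (Rmax_Cmod ((u, v) - (x, y))%C) as hm.
change (Rmax (Rabs (u - x)) (Rabs (v - y)) <= Cmod ((u, v) - (x, y))) in hm.
pose proof (Rmax_l (Rabs (u - x)) (Rabs (v - y))). pose proof (Rmax_r (Rabs (u - x)) (Rabs (v - y))).
specialize (h1 u v ltac:(lra) ltac:(lra)). specialize (h2 u v ltac:(lra) ltac:(lra)).
cbn [pos] in h1, h2.
set (X := Cmod ((u, v) - (x, y))) in *. set (m := Rmax _ _) in *.
set (k := (f (u, v) - f (x, y) - (p, q) * ((u, v) - (x, y)))%C).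
assert (k1 : Rabs (Re k) <= e / 2 * X).
{ eapply Rle_trans; [|apply (Rmult_le_compat_l (e / 2) m X); lra].
  eapply Rle_trans; [|exact h1]. right; f_equal. unfold k; cring. }
assert (k2 : Rabs (Im k) <= e / 2 * X).
{ eapply Rle_trans; [|apply (Rmult_le_compat_l (e / 2) m X); lra].
  eapply Rle_trans; [|exact h2]. right; f_equal. unfold k; cring. }
assert (X0 : 0 <= X) by apply Cmod_ge_0.
apply le_of_pow2_le; [apply Rmult_le_pos; lra|]. rewrite Cmod2_alt.
apply Rabs_le_between in k1. apply Rabs_le_between in k2.
assert (0 <= e / 2 * X) by (apply Rmult_le_pos; lra). nra.
Qed.

Lemma differentiable_plus_squares x y :
  differentiable_pt_lim (fun u v => u * u + v * v) x y (2 * x) (2 * y).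
Proof.
intros e. assert (he : 0 < e / 2) by (pose proof (cond_pos e); lra).
exists (mkposreal _ he); intros u v hu hv; cbn [pos] in *.
replace (u * u + v * v - (x * x + y * y) - (2 * x * (u - x) + 2 * y * (v - y)))
  with ((u - x) * (u - x) + (v - y) * (v - y)) by ring.
rewrite Rabs_pos_eq by (apply Rplus_le_le_0_compat; apply Rle_0_sqr).
rewrite <- (Rabs_pos_eq ((u - x) * (u - x))), <- (Rabs_pos_eq ((v - y) * (v - y)))
  by apply Rle_0_sqr.
rewrite !Rabs_mult.
pose proof (Rmax_l (Rabs (u - x)) (Rabs (v - y))). pose proof (Rmax_r (Rabs (u - x)) (Rabs (v - y))).
pose proof (Rabs_pos (u - x)). pose proof (Rabs_pos (v - y)). nra.
Qed.

Lemma Carg_right_half x y : 0 < x -> Carg (x, y) = atan (y / x).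
Proof. intros hx; unfold Carg; cbn. destruct (Rlt_dec 0 x); [reflexivity|contradiction]. Qed.

Lemma Clog_cdiff z : 0 < Re z -> cdiff Clog z (/ z)%C.
Proof.
destruct z as [x y]; cbn; intros hx.
assert (S0 : 0 < x * x + y * y) by (pose proof (Rle_0_sqr y); unfold Rsqr in *; nra).
replace (/ (x, y))%C with ((x / (x * x + y * y), - y / (x * x + y * y)) : C).
2:{ unfold Cinv; cbn [fst snd]; f_equal; field; lra. }
apply cdiff_of_cauchy_riemann.
(* The dummy second argument fits a function of one variable into the chain rule for two. *)
- apply (differentiable_pt_lim_ext (fun u v => (fun s _ => ln (sqrt s)) (u * u + v * v) 0)).
  { apply locally_2d_forall; intros u v. unfold Clog, Cmod. cparts.
    replace (u ^ 2 + v ^ 2) with (u * u + v * v) by ring. ring. }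
  replace (x / (x * x + y * y)) with (/ (2 * (x * x + y * y)) * (2 * x) + 0 * 0) by (field; lra).
  replace (- (- y / (x * x + y * y))) with (/ (2 * (x * x + y * y)) * (2 * y) + 0 * 0) by (field; lra).
  apply (differentiable_pt_lim_comp (fun s _ => ln (sqrt s)) (fun u v => u * u + v * v) (fun _ _ => 0)).
  + apply differentiable_pt_lim_proj1_0, is_derive_Reals.
    pose proof (sqrt_lt_R0 _ S0). auto_derive; [lra|].
    replace (x * x + y * y) with (sqrt (x * x + y * y) * sqrt (x * x + y * y)) at 3
      by (apply sqrt_sqrt; lra). field; lra.
  + apply differentiable_plus_squares.
  + apply (differentiable_pt_lim_proj1_0 (fun _ => 0)), derivable_pt_lim_const.
- apply (differentiable_pt_lim_ext (fun u v => (fun s _ => atan s) (/ u * v) 0)).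
  (* Within distance [x] the real part stays positive, so [Carg] stays on its [atan] branch. *)
  { exists (mkposreal x hx); intros u v hu hv; cbn [pos] in hu.
    apply Rabs_def2 in hu. unfold Clog. rewrite Carg_right_half by lra. cparts.
    unfold Rdiv; rewrite (Rmult_comm v). ring. }
  replace (- y / (x * x + y * y)) with (/ (1 + (/ x * y) ^ 2) * (- / (x ^ 2) * y) + 0 * 0)
    by (field; repeat split; nra).
  replace (x / (x * x + y * y)) with (/ (1 + (/ x * y) ^ 2) * (/ x * 1) + 0 * 0)
    by (field; repeat split; nra).
  apply (differentiable_pt_lim_comp (fun s _ => atan s) (fun u v => / u * v) (fun _ _ => 0)).
  + apply differentiable_pt_lim_proj1_0. apply is_derive_Reals. auto_derive; auto. field; nra.
  + apply (differentiable_prod (fun u => / u) (fun v => v)).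
    * apply is_derive_Reals. auto_derive; [lra|field; lra].
    * apply derivable_pt_lim_id.
  + apply (differentiable_pt_lim_proj1_0 (fun _ => 0)), derivable_pt_lim_const.
Qed.

Lemma Clog_pos x : 0 < x -> Clog (RtoC x) = RtoC (ln x).
Proof.
intros hx. unfold Clog. rewrite Cmod_R, Rabs_pos_eq by lra.
unfold RtoC at 3. rewrite Carg_right_half by auto.
replace (0 / x) with 0 by (field; lra). rewrite atan_0. ring.
Qed.

(** Kept in the shape that the chain rule produces; the Möbius form is derived in
    [H1_derivative_eq]. *)
Definition H1_derivative (L : R) (z : C) : C :=
  (RtoC (L ^ 2) + RtoC (L ^ 3 - L) * (/ (1 + - / RtoC L * z) * (- / RtoC L)))%C.

Lemma RtoC_neq_0 x : x <> 0 -> RtoC x <> 0%C.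
Proof. intros h e; now apply RtoC_inj in e. Qed.

(** Keeps the argument of [Clog] away from the branch cut. *)
Lemma Re_denominator_pos L z : 1 < L -> Cmod z < 1 -> 0 < Re (1 + - / RtoC L * z)%C.
Proof.
intros hL hz. rewrite <- RtoC_inv by lra.
replace (Re (1 + - RtoC (/ L) * z)%C) with (1 - / L * Re z) by cring.
pose proof (re_le_Cmod z). assert (Re z < 1) by (apply Rabs_le_between in H; lra).
assert (0 < / L < 1).
{ split; [apply Rinv_0_lt_compat; lra|]. rewrite <- Rinv_1; apply Rinv_lt_contravar; lra. }
nra.
Qed.

Lemma H1_cdiff L z : 1 < L -> Cmod z < 1 -> cdiff (H1 L) z (H1_derivative L z).
Proof.
intros hL hz. unfold H1, H1_derivative.
apply (cdiff_ext (fun z => RtoC (L ^ 2) * z + RtoC (L ^ 3 - L) * Clog (1 + - / RtoC L * z))%C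
  _ _ _ 1); [lra| |].
- intros w _. do 3 f_equal. unfold Cdiv; ring.
- apply cdiff_plus.
  + replace (RtoC (L ^ 2)) with (RtoC (L ^ 2) * 1)%C at 2 by ring. apply cdiff_scal, cdiff_id.
  + apply cdiff_scal. apply (cdiff_comp (fun z => 1 + - / RtoC L * z)%C Clog).
    * apply cdiff_affine.
    * apply Clog_cdiff. now apply Re_denominator_pos.
Qed.

Lemma H1_derivative_eq L z : 1 < L -> Cmod z < 1 ->
  H1_derivative L z = (RtoC L * ((1 - RtoC L * z) / (RtoC L - z)))%C /\ (RtoC L - z)%C <> 0%C.
Proof.
intros hL hz.
assert (nL : RtoC L <> 0%C) by (apply RtoC_neq_0; lra).
assert (n2 : (RtoC L - z)%C <> 0%C).
{ apply Cmod_gt_0. pose proof (Cmod_minus_triangle_rev (RtoC L) z) as h.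
  rewrite Cmod_R, Rabs_pos_eq in h; lra. }
split; auto.
unfold H1_derivative. rewrite RtoC_minus, !RtoC_pow.
assert (n3 : (1 + - / RtoC L * z)%C <> 0%C).
{ intros e; pose proof (Re_denominator_pos L z hL hz) as h; rewrite e in h; simpl in h; lra. }
field. auto.
Qed.

Lemma H1_derivative_lt L z : 1 < L -> Cmod z < 1 -> Cmod (H1_derivative L z) < L.
Proof.
intros hL hz. destruct (H1_derivative_eq L z hL hz) as [-> n].
assert (nL : RtoC L <> 0%C) by (apply RtoC_neq_0; lra).
rewrite Cmod_mult, Cmod_div, Cmod_R, Rabs_pos_eq by (auto; lra).
apply Rlt_le_trans with (L * 1); [|lra]. apply Rmult_lt_compat_l; [lra|].
apply Cmod_gt_0 in n. apply Rlt_div_l; auto. rewrite Rmult_1_l.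
assert (i1 : 0 < / L < 1).
{ split; [apply Rinv_0_lt_compat; lra|]. rewrite <- Rinv_1; apply Rinv_lt_contravar; lra. }
assert (ha : Cmod (RtoC (/ L)) < 1) by (rewrite Cmod_R, Rabs_pos_eq; lra).
pose proof (blaschke_lt (RtoC (/ L)) z ha hz) as h.
apply (Rmult_lt_compat_l (Cmod (RtoC L))) in h; [|now apply Cmod_gt_0].
rewrite <- !Cmod_mult in h.
replace (Cconj (RtoC (/ L))) with (RtoC (/ L)) in h by (cparts; f_equal; ring).
rewrite RtoC_inv in h by lra.
rewrite Cmod_minus_sym.
replace (RtoC L * z - 1)%C with (RtoC L * (z - / RtoC L))%C by (field; auto).
replace (RtoC L - z)%C with (RtoC L * (1 - / RtoC L * z))%C by (field; auto). exact h.
Qed.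

Lemma extremal_hyp L1 L2 : 0 <= L1 -> 1 < L2 ->
  hyp L1 L2 (G1 L1) (H1 L2) (fun _ => (- RtoC L1)%C) (H1_derivative L2).
Proof.
intros h1 h2. assert (nL : RtoC L2 <> 0%C) by (apply RtoC_neq_0; lra).
refine (conj _ (conj _ (conj _ (conj _ (conj _ (conj _ _)))))).
- intros z _. apply has_cderiv_cdiff. unfold G1.
  apply (cdiff_ext (fun z => 0 + - RtoC L1 * z)%C _ _ _ 1); [lra|intros; ring|apply cdiff_affine].
- intros z hz. apply has_cderiv_cdiff. now apply H1_cdiff.
- unfold G1; ring.
- unfold H1. replace (1 - 0 / RtoC L2)%C with (RtoC 1) by (field; auto).
  rewrite Clog_pos, ln_1 by lra. ring.
- destruct (H1_derivative_eq L2 0 h2) as [-> n]; [rewrite Cmod_0; lra|]. field; auto.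
- intros z _. rewrite Cmod_opp, Cmod_R, Rabs_pos_eq; lra.
- intros z hz. now apply H1_derivative_lt.
Qed.

Lemma F1_decomposition L1 L2 z : F1 L1 L2 z = (Cconj z * G1 L1 z + H1 L2 z)%C.
Proof.
unfold F1, G1, H1. rewrite RtoC_mult, Cmod2_conj. ring.
Qed.

Lemma F1_real L1 L2 x : 1 < L2 -> x < 1 -> 0 <= x -> F1 L1 L2 (RtoC x) = RtoC (sigma_at L1 L2 x).
Proof.
intros h2 hx hx0. unfold F1, sigma_at.
assert (x / L2 < 1) by (apply Rlt_div_l; lra).
replace (1 - RtoC x / RtoC L2)%C with (RtoC (1 - x / L2)) by (rewrite RtoC_minus, RtoC_div; auto; lra).
rewrite Clog_pos by lra. rewrite Cmod_R, Rabs_pos_eq by lra.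
rewrite RtoC_plus, (RtoC_minus (L2 ^ 2 * x)), !RtoC_mult. ring.
Qed.

(* sigma_at increases up to rho1 and decreases afterwards, so F1 takes a common real
   value on both sides of rho1. *)
Lemma F1_not_univalent L1 L2 r : 0 <= L1 -> 1 < L2 -> rho1 L1 L2 < r <= 1 ->
  ~ univalent_on (F1 L1 L2) (cdisc r).
Proof.
intros h1 h2 hr hu. destruct (rho1_spec L1 L2 h1 h2) as [r1 r2].
set (rho := rho1 L1 L2) in *. set (f := sigma_at L1 L2) in *.
set (x2 := (rho + r) / 2). assert (hx2 : rho < x2 < r) by (unfold x2; lra).
assert (below : f x2 < f rho).
{ destruct (MVT_cor2 f (mu L1 L2) rho x2) as (c & e & hc); [lra| |].
  - intros c hc; apply is_derive_Reals, sigma_derive; lra.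
  - pose proof (mu_decreasing L1 L2 rho c h1 h2 ltac:(lra)). nra. }
assert (inj : forall x y, 0 <= x < r -> 0 <= y < r -> f x = f y -> x = y).
{ intros x y hx hy e. apply RtoC_inj, hu.
  - unfold cdisc; rewrite Cmod_R, Rabs_pos_eq; lra.
  - unfold cdisc; rewrite Cmod_R, Rabs_pos_eq; lra.
  - rewrite !F1_real by lra. unfold f in e; now rewrite e. }
pose proof (sigma_increasing L1 L2 (rho / 2) rho h1 h2 ltac:(lra) ltac:(unfold rho; lra)) as left_below.
fold f in left_below.
(* A level below the peak [f rho] but not below either outer value, hence taken on both sides; a
   common preimage could only be [rho], where [f] exceeds it. *)
set (v := Rmax (f (rho / 2)) (f x2)).
assert (v1 : f (rho / 2) <= v) by apply Rmax_l. assert (v2 : f x2 <= v) by apply Rmax_r.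
assert (v3 : v < f rho) by now apply Rmax_lub_lt.
assert (fc : forall x, x < 1 -> continuity_pt f x) by (intros; now apply sigma_continuous).
destruct (f_interv_is_interv f (rho / 2) rho v) as (x & hx & ex);
  [lra|lra|intros; apply fc; lra|].
(* The intermediate value theorem expects the smaller value at the left end, hence the sign change
   on the descending side. *)
destruct (f_interv_is_interv (fun t => - f t) rho x2 (- v)) as (y & hy & ey);
  [lra|lra|intros; apply continuity_pt_opp, fc; lra|].
apply Ropp_eq_compat in ey; rewrite !Ropp_involutive in ey.
assert (e : x = y) by (apply inj; [lra|lra|now rewrite ey]).
assert (xr : x = rho) by lra. rewrite xr in ex. lra.
Qed.

Lemma sigma_at_rho1_nonneg L1 L2 : 0 <= L1 -> 1 < L2 -> 0 <= sigma_at L1 L2 (rho1 L1 L2).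
Proof.
intros h1 h2. destruct (rho1_spec L1 L2 h1 h2) as [r1 _].
rewrite <- (sigma_0 L1 L2 h2). left; apply sigma_increasing; lra.
Qed.

Theorem theorem2p1 (L1 L2 : R) (hL1 : 0 <= L1) (hL2 : 1 < L2)
  (G H G' H' : C -> C) (hyps : hyp L1 L2 G H G' H') :
  let F := fun z : C => (Cconj z * G z + H z)%C in
  (univalent_on F (cdisc (rho1 L1 L2))
   /\ (forall w, cdisc (sigma1 L1 L2) w ->
         exists z, cdisc (rho1 L1 L2) z /\ F z = w))
  /\
  ((exists G1' H1' : C -> C, hyp L1 L2 (G1 L1) (H1 L2) G1' H1')
   /\ (forall z, F1 L1 L2 z = (Cconj z * G1 L1 z + H1 L2 z)%C)
   /\ (forall r, rho1 L1 L2 < r <= 1 -> ~ univalent_on (F1 L1 L2) (cdisc r))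
   /\ Cmod (F1 L1 L2 (RtoC (rho1 L1 L2))) = sigma1 L1 L2
   /\ Cmod (RtoC (rho1 L1 L2)) = rho1 L1 L2).
Proof.
destruct (rho1_spec L1 L2 hL1 hL2) as [r1 _].
intros F; split; [split|split; [|split; [|split; [|split]]]].
- exact (F_univalent L1 L2 hL1 hL2 G H G' H' hyps).
- intros w hw. exact (bianalytic_covering L1 L2 G H G' H' w hL1 hL2 hyps hw).
- exists (fun _ => (- RtoC L1)%C), (H1_derivative L2). now apply extremal_hyp.
- apply F1_decomposition.
- intros r hr. now apply F1_not_univalent.
- rewrite F1_real by lra. rewrite Cmod_R. apply Rabs_pos_eq, sigma_at_rho1_nonneg; auto.
- rewrite Cmod_R. apply Rabs_pos_eq; lra.
Qed.
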